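(* Let $(\Omega,\mathcal A,\mu)$ be a $\sigma$-finite measure space and $\tau:\Omega\to\Omega$ a measure preserving transformation. Given $f\in\mathcal R_\mu$, there exists a set $\Omega_f\subset\Omega$ with $\mu(\Omega\setminus\Omega_f)=0$ such that the averages \[ \frac1n\sum_{k=0}^{n-1}\beta_kf(\tau^k\omega) \] converge (as $n\to\infty$) for every $\omega\in\Omega_f$ and every bounded Besicovitch sequence $\{\beta_k\}_{k\ge0}$.
   Context: $\mathcal L^p=\mathcal L^p(\Omega,\mu)$ are complex-valued function spaces, and $\mathcal R_\mu=\{f\in\mathcal L^1+\mathcal L^\infty:\ \mu\{|f|>\lambda\}<\infty\text{ for all }\lambda>0\}$. Pointwise values of $f$ refer to a fixed representative. With $\mathbb C_1=\{z\in\mathbb C:|z|=1\}$, a trigonometric polynomial is a function $P:\mathbb Z\to\mathbb C$ of the form $P(k)=\sum_{j=1}^s z_j\lambda_j^k$ with $s\in\mathbb N$, $z_j\in\mathbb C$, $\lambda_j\in\mathbb C_1$. A sequence $\{\beta_k\}_{k\ge0}\subset\mathbb C$ is a bounded Besicovitch sequence if (i) $|\beta_k|\le C$ for all $k$ and some $C<\infty$; (ii) for every $\varepsilon>0$ there is a trigonometric polynomial $P$ with $\limsup_n\frac1n\sum_{k=0}^{n-1}|\beta_k-P(k)|<\varepsilon$. *)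

(* Defs.v *)
From mathcomp Require Import all_boot all_order all_algebra.
From mathcomp Require Import complex.
From mathcomp Require Import all_classical all_reals all_analysis.

Set Implicit Arguments.
Unset Strict Implicit.
Unset Printing Implicit Defensive.
Import Order.TTheory GRing.Theory Num.Theory.
Import numFieldNormedType.Exports.

Local Open Scope classical_set_scope.
Local Open Scope ring_scope.

Section function_spaces.
Context d (T : measurableType d) (R : realType).
Variable mu : {measure set T -> \bar R}.

(* [R[i]] carries no measurable structure in the library. *)
Definition cmeasurable (f : T -> R[i]) : Prop :=
  measurable_fun [set: T] (fun x => complex.Re (f x)) /\
  measurable_fun [set: T] (fun x => complex.Im (f x)).

(* Functions rather than classes modulo null sets: membership refers to the
   given representative. [Normc.normc] is the modulus with values in [R],
   whereas [`|z|] is a (real) element of [R[i]]. *)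
Definition cLfun (p : \bar R) : set (T -> R[i]) :=
  [set f | cmeasurable f /\ finite_norm mu p (fun x => Normc.normc (f x))].

Definition Rmu : set (T -> R[i]) :=
  [set f | (exists g h : T -> R[i],
              [/\ cLfun 1%E g, cLfun +oo%E h & f = (fun x => g x + h x)]) /\
           forall lambda : R, 0 < lambda ->
             (mu [set x | (lambda < Normc.normc (f x))%R] < +oo)%E].

Definition measure_preserving (tau : T -> T) : Prop :=
  measurable_fun [set: T] tau /\
  forall A : set T, measurable A -> mu (tau @^-1` A) = mu A.

End function_spaces.

Section besicovitch.
Context (R : realType).

Definition trig_poly (P : int -> R[i]) : Prop :=
  exists (s : nat) (z lambda : 'I_s -> R[i]),
    (forall j, Normc.normc (lambda j) = 1) /\
    forall k : int, P k = \sum_(j < s) z j * lambda j ^ k.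

(* The terms of index [n = 0] in the averages are [0], as [0^-1 = 0]. *)
Definition bounded_besicovitch (beta : nat -> R[i]) : Prop :=
  (exists C : R, forall k, Normc.normc (beta k) <= C) /\
  forall eps : R, 0 < eps ->
    exists2 P : int -> R[i], trig_poly P &
      (limn_esup (fun n : nat =>
         (n%:R^-1 * \sum_(0 <= k < n) Normc.normc (beta k - P k%:Z))%:E)
       < eps%:E)%E.

(* The regular module [R[i]^o] gives access to the norm topology of [R[i]]. *)
Definition weighted_average (T : Type) (tau : T -> T) (beta : nat -> R[i])
    (f : T -> R[i]) (x : T) (n : nat) : R[i]^o :=
  n%:R^-1 * \sum_(0 <= k < n) beta k * f (iter k tau x).

End besicovitch.

(* Main.v *)
Require Import Defs.
From mathcomp Require Import all_boot all_order all_algebra.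
From mathcomp Require Import complex.
From mathcomp Require Import all_classical all_reals all_analysis.
From mathcomp Require Import measurable_realfun ess_sup_inf.
From mathcomp Require Import ring lra.

(** The averages are weighted by an arbitrary Besicovitch sequence, but such a
    sequence is a limit of trigonometric polynomials for the Cesaro seminorm
    limsup (1/n) sum_(k<n) |.|, and this seminorm controls the averages along
    any sequence f(tau^k x) that is, in the same seminorm, a limit of bounded
    ones.  For f in R_mu this second approximation is truncation: off a null
    set, {1/(m+1) < |f| <= m+1} captures f up to a small upper average, because
    |f| <= 1/(m+1) is uniformly small and the part of f where |f| > m+1 has an
    integral tending to 0, to which the weak-type maximal inequality applies
    ([upper_tail_average]).  The truncations are bounded, supported on sets of
    finite measure, hence integrable.

    What remains is the Wiener-Wintner theorem ([wiener_wintner]): for f real,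
    bounded and integrable there is ONE null set off which the averages of
    cos(k theta + t) f(tau^k x) converge for ALL theta and t.  Uncountably many
    frequencies theta are involved, and the invariant sigma-algebra may be
    large, so the exceptional frequencies cannot be listed once and for all: they
    depend on x.  For a point x and a frequency theta, let the mean power of
    length H be the Cesaro mean over k of
    |(1/H) sum_(j<H) e^(i j theta) f(tau^(k+j) x)|^2; as H grows it tends to the
    mass that the spectral measure of the orbit has at -theta.
    - By the van der Corput argument ([van_der_corput]), if some mean powers at
      theta are arbitrarily small, then the averages at theta tend to 0.
    - By Bessel's inequality on each window ([bessel_window]), only finitely
      many theta are exceptional of level delta > 0, in the sense that all their
      mean powers are at least delta.
    Thus each exceptional frequency is the first one of its level after some
    rational p, and is therefore the value at x of one of countably many
    measurable tau-invariant functions theta(x) ([selector]).  For such a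
    function the averages converge almost everywhere, by the pointwise ergodic
    theorem applied to the skew product (x, t) -> (tau x, t + theta(x)) on the
    product with the circle ([twisted_birkhoff]): this is where sigma-finiteness
    enters.

    The pointwise ergodic theorem in a space of infinite measure is obtained
    from Garsia's proof of the maximal ergodic theorem: the set where the lower
    average is below a and the upper one above b > a has finite measure by the
    maximal inequality, and comparing integrals over it shows that it is null
    ([crossing_null]). *)

Set Implicit Arguments.
Unset Strict Implicit.
Unset Printing Implicit Defensive.
Import Order.TTheory GRing.Theory Num.Theory.
Import numFieldNormedType.Exports.

Local Open Scope classical_set_scope.
Local Open Scope ring_scope.

(** * Cesaro averages *)

Section averages.
Context {R : realType}.
Implicit Types (u v a : nat -> R) (C theta : R) (n : nat).

Definition avg u n : R := n%:R^-1 * \sum_(0 <= k < n) u k.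

Lemma eq_avg u v n : (forall k, u k = v k) -> avg u n = avg v n.
Proof. by move=> uv; rewrite /avg; congr (_ * _); apply: eq_bigr. Qed.

Lemma avgD u v n : avg (fun k => u k + v k) n = avg u n + avg v n.
Proof. by rewrite /avg big_split mulrDr. Qed.

Lemma avgZ c u n : avg (fun k => c * u k) n = c * avg u n.
Proof. by rewrite /avg -mulr_sumr mulrCA. Qed.

Lemma avgB u v n : avg (fun k => u k - v k) n = avg u n - avg v n.
Proof. by rewrite /avg sumrB mulrBr. Qed.

Lemma avg_sum (I : Type) (s : seq I) (u : I -> nat -> R) n :
  avg (fun k => \sum_(i <- s) u i k) n = \sum_(i <- s) avg (u i) n.
Proof. by rewrite /avg exchange_big mulr_sumr. Qed.

Lemma avg_exchange (u : nat -> nat -> R) n m :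
  avg (fun k => avg (u k) m) n = avg (fun j => avg (u ^~ j) n) m.
Proof.
by rewrite /avg -!mulr_sumr exchange_big mulrCA.
Qed.

Lemma ler_avg u v n : (forall k, u k <= v k) -> avg u n <= avg v n.
Proof. by move=> uv; rewrite /avg ler_wpM2l ?invr_ge0// ler_sum. Qed.

Lemma avg_ge0 u n : (forall k, 0 <= u k) -> 0 <= avg u n.
Proof. by move=> u0; rewrite /avg mulr_ge0 ?invr_ge0// sumr_ge0. Qed.

Lemma ler_norm_avg u n : `|avg u n| <= avg (fun k => `|u k|) n.
Proof.
rewrite /avg normrM ger0_norm ?invr_ge0// ler_wpM2l ?invr_ge0//.
exact: ler_norm_sum.
Qed.

Lemma avg_cst c n : (0 < n)%N -> avg (fun=> c) n = c.
Proof.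
move=> n0; rewrite /avg sumr_const_nat subn0 -(mulr_natl c n) mulrA mulVf ?mul1r//.
by rewrite pnatr_eq0 -lt0n.
Qed.

Lemma avg_le_cst u c n : 0 <= c -> (forall k, u k <= c) -> avg u n <= c.
Proof.
move=> c0 uc; have [->|n0] := posnP n; first by rewrite /avg big_nil mulr0.
by rewrite -[leRHS](avg_cst c n0) ler_avg.
Qed.

Lemma avg_bounded u C n : (forall k, `|u k| <= C) -> `|avg u n| <= C.
Proof.
move=> uC; rewrite (le_trans (ler_norm_avg _ _))// avg_le_cst//.
exact: le_trans (uC 0%N).
Qed.

(** Moving the window of summation by [j] changes [j] boundary terms at each
    end. *)
Lemma avg_shift u C j n : (forall k, `|u k| <= C) ->
  `|avg (fun k => u (k + j)%N) n - avg u n| <= j%:R * (2 * C) / n%:R.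
Proof.
move=> uC; rewrite /avg -mulrBr normrM ger0_norm ?invr_ge0// mulrC.
rewrite ler_wpM2r ?invr_ge0//.
elim: j => [|j IH].
  under eq_bigr do rewrite addn0.
  by rewrite subrr normr0 mul0r.
set A := \sum_(0 <= k < n) u k in IH *.
set B := \sum_(0 <= k < n) u (k + j)%N in IH.
rewrite (_ : \sum_(0 <= k < n) u (k + j.+1)%N = B + (u (n + j)%N - u j)).
  rewrite addrAC (le_trans (ler_normD _ _))// -natr1 mulrDl mul1r lerD//.
  rewrite (le_trans (ler_normB _ _))// mulr_natl mulr2n lerD//.
rewrite /B; under eq_bigr do rewrite addnS -addSn.
have := telescope_sumr (fun k => u (k + j)%N) (leq0n n).
rewrite sumrB add0n => <-; by rewrite addrC subrK.
Qed.

Lemma avgN u n : avg (fun k => - u k) n = - avg u n.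
Proof. by rewrite /avg sumrN mulrN. Qed.

Lemma is_cvg_avg_sum (I : Type) (s : seq I) (u : I -> nat -> R) :
  (forall i, cvg (avg (u i) @ \oo)) ->
  cvg (avg (fun k => \sum_(i <- s) u i k) @ \oo).
Proof.
move=> uc; elim: s => [|i s IH].
  rewrite (_ : avg _ = cst 0); first exact: is_cvg_cst.
  apply/funext => n; rewrite /avg big1 ?mulr0// => k _; exact: big_nil.
rewrite (_ : avg _ = (fun n => avg (u i) n + avg (fun k => \sum_(i <- s) u i k) n)).
  exact: is_cvgD.
by apply/funext => n; rewrite -avgD; apply: eq_avg => k; rewrite big_cons.
Qed.

(** A sequence that is eventually within any distance of some convergent
    sequence is Cauchy. *)
Lemma is_cvg_approx (u : nat -> R) :
  (forall e, 0 < e -> exists2 v : nat -> R, cvg (v @ \oo) &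
    \forall n \near \oo, `|u n - v n| <= e) -> cvg (u @ \oo).
Proof.
move=> H; apply/cauchy_cvgP; apply: cauchy_exP => e e0.
have e20 : 0 < e / 3 by rewrite divr_gt0.
have [v /cvg_ex[l /cvgrPdist_le vl] uv] := H _ e20.
exists l; suff : \forall n \near \oo, `|l - u n| < e by [].
near=> n.
have h1 : `|l - v n| <= e / 3 by near: n; exact: vl.
have h2 : `|u n - v n| <= e / 3 by near: n.
have := ler_normD (l - v n) (v n - u n).
rewrite addrA subrK (distrC (v n)); lra.
Unshelve. all: by end_near. Qed.

End averages.

(** * Trigonometric averages over a window *)

Section trigonometric_windows.
Context {R : realType}.
Implicit Types (u v a : nat -> R) (C theta phi : R) (n H N : nat).

Lemma ler_norm_sin (x : R) : `|sin x| <= `|x|.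
Proof.
wlog x0 : x / 0 <= x.
  move=> W; have [/W//|x0] := leP 0 x.
  by have := W (- x); rewrite sinN !normrN; apply; lra.
rewrite (ger0_norm x0).
have [->|xn0] := eqVneq x 0; first by rewrite sin0 normr0.
have xp : 0 < x by rewrite lt_neqAle eq_sym xn0.
have [|c _] := @MVT R sin cos 0 x xp (fun y _ => is_derive_sin y).
  by apply: continuous_subspaceT => y; exact: continuous_sin.
rewrite sin0 !subr0 => ->.
by rewrite normrM (ger0_norm x0) ler_piMl// cos_max.
Qed.

Lemma cosB_cos (x y : R) :
  cos x - cos y = - 2 * (sin ((x + y) / 2) * sin ((x - y) / 2)).
Proof.
set p := (x + y) / 2; set q := (x - y) / 2.
have -> : x = p + q by rewrite /p /q; lra.
have -> : y = p - q by rewrite /p /q; lra.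
by rewrite cosD cosB; ring.
Qed.

Lemma sinB_sin (x y : R) :
  sin x - sin y = 2 * (cos ((x + y) / 2) * sin ((x - y) / 2)).
Proof.
set p := (x + y) / 2; set q := (x - y) / 2.
have -> : x = p + q by rewrite /p /q; lra.
have -> : y = p - q by rewrite /p /q; lra.
by rewrite sinD sinB; ring.
Qed.

Lemma cos_lipschitz (x y : R) : `|cos x - cos y| <= `|x - y|.
Proof.
rewrite cosB_cos !normrM normrN (ger0_norm (ler0n R 2)).
have := ler_norm_sin ((x - y) / 2).
rewrite normrM (ger0_norm (_ : 0 <= 2^-1)) ?invr_ge0// => h.
have : `|sin ((x + y) / 2)| * `|sin ((x - y) / 2)| <= 1 * (`|x - y| / 2).
  by rewrite ler_pM// sin_max.
lra.
Qed.

Lemma sin_lipschitz (x y : R) : `|sin x - sin y| <= `|x - y|.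
Proof.
by rewrite -!cosBpihalf (le_trans (cos_lipschitz _ _))// opprB addrA subrK.
Qed.

(** The cosine sum telescopes after multiplication by sin(phi/2); boundedness of
    the sum makes distinct frequencies asymptotically orthogonal on a window. *)
Lemma dirichlet_cos phi n : sin (phi / 2) != 0 ->
  `|avg (fun j => cos (j%:R * phi)) n| <= `|sin (phi / 2)|^-1 / n%:R.
Proof.
move=> s0; rewrite /avg normrM ger0_norm ?invr_ge0// mulrC ler_wpM2r ?invr_ge0//.
rewrite -(ler_pM2l (x := `|sin (phi / 2)|)) ?normr_gt0// divff ?normr_eq0//.
rewrite -normrM mulr_sumr.
have E k : sin (phi / 2) * cos (k%:R * phi) =
    (sin (k.+1%:R * phi - phi / 2) - sin (k%:R * phi - phi / 2)) / 2.
  rewrite sinB_sin -[k.+1%:R]natr1.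
  have -> : ((k%:R + 1) * phi - phi / 2 + (k%:R * phi - phi / 2)) / 2 = k%:R * phi by lra.
  have -> : ((k%:R + 1) * phi - phi / 2 - (k%:R * phi - phi / 2)) / 2 = phi / 2 by lra.
  lra.
under eq_bigr do rewrite E.
rewrite -mulr_suml (telescope_sumr (fun k => sin (k%:R * phi - phi / 2)))//.
rewrite normrM (ger0_norm (_ : 0 <= 2^-1)) ?invr_ge0//.
have := ler_normB (sin (n%:R * phi - phi / 2)) (sin (0%:R * phi - phi / 2)).
have := sin_max (n%:R * phi - phi / 2); have := sin_max (0%:R * phi - phi / 2).
lra.
Qed.

Lemma dirichlet_sin phi n : sin (phi / 2) != 0 ->
  `|avg (fun j => sin (j%:R * phi)) n| <= `|sin (phi / 2)|^-1 / n%:R.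
Proof.
move=> s0; rewrite /avg normrM ger0_norm ?invr_ge0// mulrC ler_wpM2r ?invr_ge0//.
rewrite -(ler_pM2l (x := `|sin (phi / 2)|)) ?normr_gt0// divff ?normr_eq0//.
rewrite -normrM mulr_sumr.
have E k : sin (phi / 2) * sin (k%:R * phi) =
    - (cos (k.+1%:R * phi - phi / 2) - cos (k%:R * phi - phi / 2)) / 2.
  rewrite cosB_cos -[k.+1%:R]natr1.
  have -> : ((k%:R + 1) * phi - phi / 2 + (k%:R * phi - phi / 2)) / 2 = k%:R * phi by lra.
  have -> : ((k%:R + 1) * phi - phi / 2 - (k%:R * phi - phi / 2)) / 2 = phi / 2 by lra.
  lra.
under eq_bigr do rewrite E.
rewrite -mulr_suml sumrN (telescope_sumr (fun k => cos (k%:R * phi - phi / 2)))//.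
rewrite normrM normrN (ger0_norm (_ : 0 <= 2^-1)) ?invr_ge0//.
have := ler_normB (cos (n%:R * phi - phi / 2)) (cos (0%:R * phi - phi / 2)).
have := cos_max (n%:R * phi - phi / 2); have := cos_max (0%:R * phi - phi / 2).
lra.
Qed.

(** Real and imaginary parts, and squared modulus, of
    (1/H) sum_(j<H) e^(i j theta) a_j. *)
Definition window_cos H theta a := avg (fun j => cos (j%:R * theta) * a j) H.
Definition window_sin H theta a := avg (fun j => sin (j%:R * theta) * a j) H.
Definition window_power H theta a := window_cos H theta a ^+ 2 + window_sin H theta a ^+ 2.

Lemma window_cos_le H theta a C : (forall j, `|a j| <= C) -> `|window_cos H theta a| <= C.
Proof.
move=> aC; apply: avg_bounded => j; rewrite normrM.
by rewrite -[leRHS]mul1r ler_pM// cos_max.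
Qed.

Lemma window_sin_le H theta a C : (forall j, `|a j| <= C) -> `|window_sin H theta a| <= C.
Proof.
move=> aC; apply: avg_bounded => j; rewrite normrM.
by rewrite -[leRHS]mul1r ler_pM// sin_max.
Qed.

Lemma window_power_ge0 H theta a : 0 <= window_power H theta a.
Proof. by rewrite addr_ge0// sqr_ge0. Qed.

Lemma window_power_le H theta a C : (forall j, `|a j| <= C) ->
  window_power H theta a <= 2 * C ^+ 2.
Proof.
move=> aC; rewrite mulr_natl mulr2n lerD// -real_normK ?num_real// lerXn2r ?nnegrE//.
- exact: le_trans (aC 0%N).
- exact: window_cos_le.
- exact: le_trans (aC 0%N).
- exact: window_sin_le.
Qed.

Let window_lipschitz H theta theta' a C (g : R -> R) :
  (forall x y, `|g x - g y| <= `|x - y|) -> (forall j, `|a j| <= C) ->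
  `|avg (fun j => g (j%:R * theta) * a j) H -
    avg (fun j => g (j%:R * theta') * a j) H| <= H%:R * C * `|theta - theta'|.
Proof.
move=> lg aC; have C0 : 0 <= C by exact: le_trans (aC 0%N).
have [->|H0] := posnP H; first by rewrite /avg !big_nil subrr normr0 !mul0r.
rewrite -avgB (le_trans (ler_norm_avg _ _))// /avg.
rewrite mulrC ler_pdivrMr ?ltr0n//.
rewrite (le_trans (_ : _ <= \sum_(0 <= k < H) H%:R * C * `|theta - theta'|))//.
  rewrite big_nat_cond [leRHS]big_nat_cond ler_sum// => j /andP[/andP[_ jH] _].
  rewrite -mulrBl normrM mulrAC ler_pM// (le_trans (lg _ _))//.
  by rewrite -mulrBr normrM normr_nat ler_wpM2r// ler_nat ltnW.
by rewrite sumr_const_nat subn0 mulr_natr.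
Qed.

Lemma window_power_lipschitz H theta theta' a C : (forall j, `|a j| <= C) ->
  `|window_power H theta a - window_power H theta' a| <= 4 * H%:R * C ^+ 2 * `|theta - theta'|.
Proof.
move=> aC; have C0 : 0 <= C by exact: le_trans (aC 0%N).
have D x y e : `|x| <= C -> `|y| <= C -> `|x - y| <= e ->
    `|x ^+ 2 - y ^+ 2| <= 2 * C * e.
  move=> xC yC xye; rewrite subr_sqr normrM mulrC ler_pM//.
  by rewrite (le_trans (ler_normD _ _))// mulr_natl mulr2n lerD.
have h1 := D _ _ _ (window_cos_le H theta aC) (window_cos_le H theta' aC)
  (window_lipschitz H theta theta' cos_lipschitz aC).
have h2 := D _ _ _ (window_sin_le H theta aC) (window_sin_le H theta' aC)
  (window_lipschitz H theta theta' sin_lipschitz aC).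
rewrite /window_power opprD addrACA (le_trans (ler_normD _ _))//.
rewrite (le_trans (lerD h1 h2))//.
by rewrite le_eqVlt; apply/orP; left; apply/eqP; ring.
Qed.

(** Up to a boundary error, the average at frequency [theta] is the average of
    the windowed averages, rotated by the phase at the start of each window.
    Each of these is controlled by the square root of the window power, which
    |w| <= e/2 + w^2/(2e) linearizes. *)
Lemma van_der_corput a C e theta t H N : (forall k, `|a k| <= C) -> 0 < e ->
  (0 < H)%N -> (0 < N)%N ->
  `|avg (fun k => cos (k%:R * theta + t) * a k) N| <=
  e + avg (fun k => window_power H theta (fun j => a (k + j)%N)) N / (2 * e)
    + H%:R * (2 * C) / N%:R.
Proof.
move=> aC e0 H0 N0; have C0 : 0 <= C by exact: le_trans (aC 0%N).
set b := fun k => cos (k%:R * theta + t) * a k.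
have bC k : `|b k| <= C.
  by rewrite normrM -[leRHS]mul1r ler_pM// cos_max.
pose v k := avg (fun j => b (k + j)%N) H.
have vE k : v k = cos (k%:R * theta + t) * window_cos H theta (fun j => a (k + j)%N)
    - sin (k%:R * theta + t) * window_sin H theta (fun j => a (k + j)%N).
  rewrite /window_cos /window_sin -!avgZ -avgB; apply: eq_avg => j.
  rewrite /b natrD mulrDl addrAC cosD; ring.
have vle k : `|v k| <= e + (2 * e)^-1 * window_power H theta (fun j => a (k + j)%N).
  rewrite vE (le_trans (ler_normB _ _))//.
  set p := window_cos _ _ _; set q := window_sin _ _ _.
  have A (c x : R) : `|c| <= 1 -> `|c * x| <= e / 2 + (2 * e)^-1 * x ^+ 2.
    move=> c1; rewrite (@le_trans _ _ `|x|)//.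
      by rewrite normrM ler_piMl.
    rewrite -(@ler_pM2l _ (2 * e)) ?mulr_gt0// mulrDr mulVKf; last first.
      by rewrite gt_eqF// mulr_gt0.
    have := sqr_ge0 (`|x| - e); rewrite sqrrB real_normK ?num_real// mulr2n.
    lra.
  rewrite (le_trans (lerD (A _ _ (cos_max _)) (A _ _ (sin_max _))))//.
  rewrite /window_power -/p -/q; lra.
have D : `|avg v N - avg b N| <= H%:R * (2 * C) / N%:R.
  have -> : avg b N = avg (fun=> avg b N) H by rewrite avg_cst.
  rewrite /v (avg_exchange (fun k j => b (k + j)%N)) -avgB.
  rewrite (le_trans (ler_norm_avg _ _))// /avg mulrC ler_pdivrMr ?ltr0n//.
  rewrite (le_trans (_ : _ <= \sum_(0 <= j < H) (H%:R * (2 * C) / N%:R)))//.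
    rewrite big_nat_cond [leRHS]big_nat_cond ler_sum// => j /andP[/andP[_ jH] _].
    rewrite (le_trans (avg_shift _ _ bC))// ler_wpM2r ?invr_ge0//.
    by rewrite ler_wpM2r ?mulr_ge0// ler_nat ltnW.
  by rewrite sumr_const_nat subn0 mulr_natr.
have V : `|avg v N| <=
    e + avg (fun k => window_power H theta (fun j => a (k + j)%N)) N / (2 * e).
  rewrite (le_trans (ler_norm_avg _ _))// (le_trans (ler_avg _ vle))//.
  by rewrite avgD avg_cst// avgZ mulrC.
have := ler_normD (avg v N) (avg b N - avg v N); rewrite addrC subrK distrC.
lra.
Qed.

(** On a window of length [H], the exponentials of frequencies in [s] are
    orthonormal up to O(1/H), with a constant that depends on [s] but not on the
    sequence.  Expanding the nonnegative mean of |a - g|^2, where [g] is the sum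
    of the components of [a] along these exponentials, gives the bound. *)
Lemma bessel_window (s : seq R) C : uniq s ->
  {in s &, forall x y, x != y -> sin ((x - y) / 2) != 0} ->
  exists K : R, forall H a, (0 < H)%N -> (forall j, `|a j| <= C) ->
    \sum_(x <- s) window_power H x a <= C ^+ 2 + K / H%:R.
Proof.
move=> us sep.
pose r (x y : R) := if x == y then 0 else `|sin ((x - y) / 2)|^-1.
exists (\sum_(x <- s) \sum_(y <- s) 4 * C ^+ 2 * r x y) => H a H0 aC.
have C0 : 0 <= C by exact: le_trans (aC 0%N).
pose p x := window_cos H x a; pose q x := window_sin H x a.
(* [g] and [h] are the real and imaginary parts of the sum over [s] of the
   conjugate window average times the exponential; [a] being real, its mean
   product with the real part [g] is the total power [E]. *)
pose g j := \sum_(x <- s) (p x * cos (j%:R * x) + q x * sin (j%:R * x)).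
pose h j := \sum_(x <- s) (p x * sin (j%:R * x) - q x * cos (j%:R * x)).
set E := \sum_(x <- s) window_power H x a.
have ag : avg (fun j => a j * g j) H = E.
  under eq_avg do rewrite mulr_sumr.
  rewrite avg_sum; apply: eq_bigr => x _.
  have -> : window_power H x a = p x * avg (fun j => cos (j%:R * x) * a j) H
    + q x * avg (fun j => sin (j%:R * x) * a j) H by rewrite /window_power !expr2.
  rewrite -!avgZ -avgD.
  by apply: eq_avg => j; ring.
pose G x y := (p x * p y + q x * q y) * avg (fun j => cos (j%:R * (x - y))) H
  + (q x * p y - p x * q y) * avg (fun j => sin (j%:R * (x - y))) H.
have gg : avg (fun j => g j ^+ 2 + h j ^+ 2) H = \sum_(x <- s) \sum_(y <- s) G x y.
  rewrite (@eq_avg _ _ (fun j => \sum_(x <- s) \sum_(y <- s)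
      ((p x * p y + q x * q y) * cos (j%:R * (x - y)) +
       (q x * p y - p x * q y) * sin (j%:R * (x - y))))); last first.
    move=> j; rewrite !expr2 /g /h !mulr_suml -big_split; apply: eq_bigr => x _ /=.
    rewrite !mulr_sumr -big_split; apply: eq_bigr => y _ /=.
    rewrite (mulrBr j%:R) cosB sinB; ring.
  rewrite avg_sum; apply: eq_bigr => x _; rewrite avg_sum; apply: eq_bigr => y _.
  by rewrite avgD !avgZ.
have Gd x : G x x = window_power H x a.
  rewrite /G subrr (@eq_avg _ _ (fun=> 1)) ?avg_cst//; last by move=> j; rewrite mulr0 cos0.
  rewrite /window_power -/(p x) -/(q x); ring.
have pC x : `|p x| <= C by exact: window_cos_le.
have qC x : `|q x| <= C by exact: window_sin_le.
have Go x y : x \in s -> y \in s -> x != y -> G x y <= 4 * C ^+ 2 * r x y / H%:R.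
  move=> xs ys xy; rewrite /r (negbTE xy).
  have s0 := sep _ _ xs ys xy.
  have h1 := dirichlet_cos H s0; have h2 := dirichlet_sin H s0.
  have M (u v w z B D : R) : `|u| <= C -> `|v| <= C -> `|w| <= C -> `|z| <= C ->
      `|B| <= D -> (u * v + w * z) * B <= 2 * C ^+ 2 * D.
    move=> uC vC wC zC BD; rewrite (le_trans (ler_norm _))// normrM ler_pM//.
    rewrite (le_trans (ler_normD _ _))// !normrM mulr_natl mulr2n expr2.
    by rewrite lerD// ler_pM.
  have m1 := M _ _ _ _ _ _ (pC x) (pC y) (qC x) (qC y) h1.
  have npC : `|- p x| <= C by rewrite normrN.
  have m2 := M _ _ _ _ _ _ (qC x) (pC y) npC (qC y) h2.
  rewrite /G -(mulNr (p x)); lra.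
have ggle : \sum_(x <- s) \sum_(y <- s) G x y <=
    E + \sum_(x <- s) \sum_(y <- s) 4 * C ^+ 2 * r x y / H%:R.
  rewrite /E -big_split/= big_seq [leRHS]big_seq ler_sum// => x xs.
  rewrite (bigD1_seq x)//= [in leRHS](bigD1_seq x)//= Gd.
  rewrite {1}/r eqxx mulr0 mul0r add0r lerD2l.
  rewrite big_seq_cond [leRHS]big_seq_cond ler_sum// => y /andP[ys yx].
  by rewrite Go// eq_sym.
have a2 : avg (fun j => a j ^+ 2) H <= C ^+ 2.
  apply: avg_le_cst; first exact: sqr_ge0.
  by move=> j; rewrite -real_normK ?num_real// lerXn2r ?nnegrE.
have := @avg_ge0 _ (fun j => (a j - g j) ^+ 2 + h j ^+ 2) H
  (fun j => addr_ge0 (sqr_ge0 _) (sqr_ge0 _)).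
rewrite (@eq_avg _ _ (fun j => a j ^+ 2 + (-2 * (a j * g j)
   + (g j ^+ 2 + h j ^+ 2)))); last by move=> j; ring.
rewrite !avgD avgZ ag -avgD gg => pos.
rewrite mulr_suml; under eq_bigr do rewrite mulr_suml.
lra.
Qed.

End trigonometric_windows.

(** * Integrable real functions *)

Section integrability.
Context d (T : measurableType d) (R : realType).
Variable mu : {measure set T -> \bar R}.
Implicit Types (f g : T -> R).

Notation integrable_real f := (mu.-integrable [set: T] (EFin \o f)).

Lemma measurable_set_ltr f g : measurable_fun setT f -> measurable_fun setT g ->
  measurable [set x | f x < g x].
Proof.
move=> mf mg; have := measurable_fun_ltr mf mg.
by move=> /(_ measurableT [set true] I); rewrite setTI.
Qed.

Lemma measurable_set_ler f g : measurable_fun setT f -> measurable_fun setT g ->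
  measurable [set x | f x <= g x].
Proof.
move=> mf mg; have := measurable_fun_ler mf mg.
by move=> /(_ measurableT [set true] I); rewrite setTI.
Qed.

Lemma integrable_measurable f : integrable_real f -> measurable_fun setT f.
Proof. by move=> /measurable_int /measurable_EFinP. Qed.

Lemma integrable_addr f g : integrable_real f -> integrable_real g ->
  integrable_real (fun x => f x + g x).
Proof.
move=> fi gi; apply: (eq_integrable measurableT ((EFin \o f) \+ (EFin \o g))%E) => //.
exact: integrableD.
Qed.

Lemma integrable_oppr f : integrable_real f -> integrable_real (fun x => - f x).
Proof.
move=> fi; apply: (eq_integrable measurableT (-%E \o (EFin \o f))) => //.
exact: integrableN.
Qed.

Lemma integrable_subr f g : integrable_real f -> integrable_real g ->
  integrable_real (fun x => f x - g x).
Proof. by move=> fi gi; apply: integrable_addr => //; exact: integrable_oppr. Qed.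

Lemma integrable_scaler c f : integrable_real f ->
  integrable_real (fun x => c * f x).
Proof.
move=> fi; apply: (eq_integrable measurableT (fun x => c%:E * (f x)%:E)%E) => //.
exact: integrableZl.
Qed.

Lemma integrable_le f g : measurable_fun setT f -> (forall x, `|f x| <= `|g x|) ->
  integrable_real g -> integrable_real f.
Proof.
move=> mf fg gi; apply: (le_integrable measurableT) gi.
  exact/measurable_EFinP.
by move=> x _; rewrite lee_fin.
Qed.

Lemma integrable_normr f : integrable_real f -> integrable_real (fun x => `|f x|).
Proof. exact: integrable_norm. Qed.

Lemma integrable_indicator (A : set T) : measurable A -> (mu A < +oo)%E ->
  integrable_real (\1_A).
Proof.
move=> mA Aoo; apply/integrableP; split; first exact/measurable_EFinP.
under eq_integral do rewrite /= ger0_norm//.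
by rewrite integral_indic// setIT.
Qed.

Lemma integrable_mul_indic f (A : set T) : measurable A -> integrable_real f ->
  integrable_real (fun x => f x * \1_A x).
Proof.
move=> mA fi; apply: (integrable_le _ _ fi).
  by apply: measurable_funM => //; exact: integrable_measurable fi.
by move=> x; rewrite normrM ler_piMr// indicE; case: (_ \in _); rewrite ?normr1 ?normr0.
Qed.

Lemma Rintegral_indic (A : set T) : measurable A -> (mu A < +oo)%E ->
  ((\int[mu]_x \1_A x)%:E = mu A)%R.
Proof.
move=> mA Aoo; rewrite /Rintegral integral_indic// setIT fineK//.
by rewrite ge0_fin_numE.
Qed.

Lemma markov_real f c : integrable_real f -> (forall x, 0 <= f x) -> 0 < c ->
  (mu [set x | (c <= f x)%R] <= (c^-1 * \int[mu]_x f x)%:E)%E.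
Proof.
move=> fi f0 c0; have mf := integrable_measurable fi.
have := @le_integral_comp_abse _ _ _ mu setT measurableT (EFin \o f) c id
  (@measurable_id _ _ setT) (fun r => id) (fun x y _ _ => id)
  (measurable_int _ fi) c0.
have -> : setT `&` [set x | (c%:E <= `|(EFin \o f) x|)%E] = [set x | c <= f x].
  by apply/seteqP; split => x /=; rewrite ger0_norm// lee_fin => -[].
under eq_integral do rewrite /= ger0_norm//.
rewrite -[X in (_ <= X -> _)%E](fineK (integrable_fin_num measurableT fi)).
by rewrite EFinM lee_pdivlMl//.
Qed.

End integrability.

(** * The maximal ergodic theorem *)

Section maximal.
Context d (T : measurableType d) (R : realType).
Variables (mu : {measure set T -> \bar R}) (tau : T -> T).
Hypothesis htau : measure_preserving mu tau.
Implicit Types (f g u : T -> R).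

Notation integrable_real f := (mu.-integrable [set: T] (EFin \o f)).
Notation orbit f x := (fun k => f (iter k tau x)).

Let mtau : measurable_fun setT tau := htau.1.

(** Change of variables: the image of [mu] under [tau] is [mu]. *)
Lemma ge0_integral_comp_preserving (F : T -> \bar R) : measurable_fun setT F ->
  (forall x, 0 <= F x)%E -> (\int[mu]_x F (tau x) = \int[mu]_x F x)%E.
Proof.
move=> mF F0; have := @ge0_integral_pushforward _ _ _ _ _ _ mtau mu setT F measurableT mF
  (fun x _ => F0 x).
rewrite preimage_setT => <-; apply: eq_measure_integral => A mA _.
exact: htau.2.
Qed.

Lemma integrable_comp_preserving f : integrable_real f ->
  integrable_real (f \o tau).
Proof.
move=> fi; have mf := integrable_measurable fi.
apply/integrableP; split; first exact/measurable_EFinP/measurableT_comp.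
rewrite (ge0_integral_comp_preserving (F := fun x => `|(f x)%:E|%E))//.
  by case/integrableP : fi.
by apply: measurableT_comp => //; exact/measurable_EFinP.
Qed.

Lemma integrable_iter f k : integrable_real f ->
  integrable_real (fun x => f (iter k tau x)).
Proof.
elim: k => // k IH fi; have := integrable_comp_preserving (IH fi).
by apply: eq_integrable => // x _ /=; rewrite -iterSr.
Qed.

Lemma ge0_Rintegral_comp_preserving f : integrable_real f -> (forall x, 0 <= f x) ->
  \int[mu]_x f (tau x) = \int[mu]_x f x.
Proof.
move=> fi f0; congr fine.
rewrite (ge0_integral_comp_preserving (F := fun x => (f x)%:E))//.
exact: measurable_int fi.
Qed.

(** The maximum of the ergodic sums of length 0, ..., n, in the recursive form
    M_(n+1) = max(0, f + M_n o tau) from which the maximal ergodic theorem can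
    be read off. *)
Fixpoint maxsum f n (x : T) : R :=
  if n is m.+1 then Num.max 0 (f x + maxsum f m (tau x)) else 0.

Lemma maxsum_ge0 f n x : 0 <= maxsum f n x.
Proof. by case: n => //= n; rewrite le_max lexx. Qed.

Lemma maxsumS f n x : maxsum f n x <= maxsum f n.+1 x.
Proof.
elim: n x => [|n IH] x; first exact: maxsum_ge0.
by rewrite [leLHS]/= [leRHS]/= ge_max !le_max lexx /= lerD2l IH orbT.
Qed.

Lemma maxsum_homo f n m x : (n <= m)%N -> maxsum f n x <= maxsum f m x.
Proof.
move=> /subnK <-; elim: (m - n)%N => // k IH.
by rewrite addSn (le_trans IH)// maxsumS.
Qed.

Lemma le_maxsum f g n x : (forall x, f x <= g x) -> maxsum f n x <= maxsum g n x.
Proof.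
move=> fg; elim: n x => //= n IH x.
by rewrite ge_max !le_max lexx /= lerD ?orbT.
Qed.

Lemma sum_le_maxsum f n x : \sum_(0 <= k < n) f (iter k tau x) <= maxsum f n x.
Proof.
elim: n x => [|n IH] x; first by rewrite big_nil.
rewrite big_nat_recl//= le_max lerD2l (le_trans _ (IH (tau x))) ?orbT//.
by rewrite ler_sum// => k _; rewrite -iterS iterSr.
Qed.

Lemma measurable_maxsum f n : measurable_fun setT f ->
  measurable_fun setT (maxsum f n).
Proof.
move=> mf; elim: n => //= n IH; apply: measurable_maxr => //.
by apply: measurable_funD => //; exact: measurableT_comp.
Qed.

Lemma integrable_maxsum f n : integrable_real f -> integrable_real (maxsum f n).
Proof.
move=> fi; elim: n => [|n IH]; first exact: integrable0.
apply: (@integrable_le _ _ _ _ _ (fun x => f x + maxsum f n (tau x))).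
- by apply: measurable_maxsum; exact: integrable_measurable fi.
- move=> x /=; set y := _ + _.
  by rewrite /Num.max; case: ifP => // _; rewrite normr0.
- exact: integrable_addr fi (integrable_comp_preserving IH).
Qed.

(** Where M_n > 0 one has M_n <= f + M_n o tau, and elsewhere
    M_n - M_n o tau <= 0; the integral of M_n - M_n o tau is 0 by invariance of
    the measure. *)
Lemma maximal_ergodic f n : integrable_real f ->
  0 <= \int[mu]_x (f x * \1_[set x | 0 < maxsum f n x] x).
Proof.
move=> fi; set P := [set x | _].
have mf := integrable_measurable fi.
have mM := measurable_maxsum n mf.
have Mi := integrable_maxsum n fi.
have mP : measurable P.
  exact: measurable_set_ltr.
have <- : \int[mu]_x (maxsum f n x - maxsum f n (tau x)) = 0.
  rewrite RintegralB//; last exact: integrable_comp_preserving.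
  rewrite ge0_Rintegral_comp_preserving ?subrr//.
  exact: maxsum_ge0.
apply: le_Rintegral => //.
- exact: integrable_subr Mi (integrable_comp_preserving Mi).
- exact: integrable_mul_indic.
move=> x _; rewrite indicE; have [|] := boolP (x \in P).
  rewrite inE /P/= mulr1 lerBlDr; case: {mM Mi mP P} n => [|n] /=; first by rewrite ltxx.
  have := maxsumS f n (tau x); rewrite -(lerD2l (f x)) /= => q.
  by rewrite lt_max ltxx/= => p; rewrite ge_max q (le_trans (ltW p) q).
move/negP; rewrite inE /P/= => /negP; rewrite -leNgt mulr0 => M0.
by rewrite subr_le0 (le_trans M0)// maxsum_ge0.
Qed.

Definition maximal_set u c := \bigcup_n [set x | 0 < maxsum (fun x => u x - c) n x].

Lemma maximal_setP u c n x : (0 < n)%N -> c < avg (orbit u x) n ->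
  maximal_set u c x.
Proof.
move=> n0 cu; exists n => //=; apply: lt_le_trans (sum_le_maxsum _ n x).
rewrite -(@ltr_pM2l _ n%:R^-1) ?invr_gt0 ?ltr0n// mulr0.
by rewrite -/(avg (fun k => u (iter k tau x) - c) n) avgB avg_cst// subr_gt0.
Qed.

Lemma measurable_maxsum_gt0 u n : measurable_fun setT u ->
  measurable [set x | 0 < maxsum u n x].
Proof.
move=> mu'; apply: measurable_set_ltr => //.
exact: measurable_maxsum.
Qed.

Lemma measurable_maximal_set u c : measurable_fun setT u ->
  measurable (maximal_set u c).
Proof.
move=> mu'; apply: bigcup_measurable => n _; apply: measurable_maxsum_gt0.
exact: measurable_funB.
Qed.

Lemma maxsum_subr u c n x : 0 < c -> 0 < maxsum (fun x => u x - c) n x ->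
  c <= maxsum u n x.
Proof.
move=> c0; case: n => [|n] /=; first by rewrite ltxx.
rewrite lt_max ltxx/= => p; rewrite le_max; apply/orP; right.
have : maxsum (fun x => u x - c) n (tau x) <= maxsum u n (tau x).
  by apply: le_maxsum => y; rewrite gerBl ltW.
lra.
Qed.

(** The constant [c] is not integrable in infinite measure, so the maximal
    ergodic theorem cannot be applied to u - c.  The sets [A n] have finite
    measure, since the maximal sums of u are at least c on them; it is applied to u - c 1_(A n),
    whose maximal sums dominate those of u - c. *)
Lemma maximal_inequality u c : integrable_real u -> (forall x, 0 <= u x) -> 0 < c ->
  (mu (maximal_set u c) <= (c^-1 * \int[mu]_x u x)%:E)%E.
Proof.
move=> ui u0 c0; have mfu := integrable_measurable ui.
pose A n := [set x | 0 < maxsum (fun x => u x - c) n x].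
have mA n : measurable (A n).
  by apply: measurable_maxsum_gt0; exact: measurable_funB.
have Aoo n : (mu (A n) < +oo)%E.
  apply: (@le_lt_trans _ _ (mu [set x | c <= maxsum u n x])).
    apply: le_measure; rewrite ?inE//.
    - apply: measurable_set_ler => //.
      exact: measurable_maxsum.
    - by move=> x /=; exact: maxsum_subr.
  apply: le_lt_trans (markov_real (integrable_maxsum n ui) _ c0) _.
    exact: maxsum_ge0.
  exact: ltry.
have Ale n : (mu (A n) <= (c^-1 * \int[mu]_x u x)%:E)%E.
  have Ii := integrable_indicator (mA n) (Aoo n).
  pose g x := u x - c * \1_(A n) x.
  have gi : integrable_real g.
    by apply: integrable_subr => //; exact: integrable_scaler.
  have := maximal_ergodic n gi; set P := [set x | _].
  have mP : measurable P.
    by apply: measurable_maxsum_gt0; exact: integrable_measurable gi.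
  have AP x : A n x -> P x.
    move=> Ax; rewrite /P/=; apply: lt_le_trans Ax _; apply: le_maxsum => y.
    by rewrite lerD2l lerN2 ler_piMr ?(ltW c0)// indicE; case: (_ \in _).
  have E x : g x * \1_P x = u x * \1_P x - c * \1_(A n) x.
    rewrite /g mulrBl -mulrA; congr (_ - _ * _); rewrite !indicE.
    have [/set_mem/AP/mem_set->|_] := boolP (x \in A n); first by rewrite mulr1.
    by rewrite mul0r.
  under eq_Rintegral do rewrite E.
  have uP := integrable_mul_indic mP ui.
  rewrite RintegralB//; last exact: integrable_scaler.
  rewrite RintegralZl//.
  have : \int[mu]_x (u x * \1_P x) <= \int[mu]_x u x.
    apply: le_Rintegral => // x _.
    by rewrite ler_piMr// indicE; case: (_ \in _).
  rewrite -Rintegral_indic// lee_fin ler_pdivlMl// => h1 h2.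
  lra.
have := @nondecreasing_cvg_mu _ _ _ mu A mA (bigcup_measurable (fun n _ => mA n)).
have ndA : nondecreasing_seq A.
  move=> n m nm; apply/subsetPset => x /=; move/lt_le_trans; apply.
  exact: maxsum_homo.
move=> /(_ ndA) cv.
rewrite -(cvg_lim _ cv)//; apply: lime_le; first by apply/cvg_ex; eexists; exact: cv.
by apply: nearW => n /=.
Qed.

(** On a forward invariant set the ergodic sums of (f - b) 1_E are those of
    f - b, so that their maxima are eventually positive at every point of [E];
    outside [E] the integrand vanishes. *)
Lemma maximal_ergodic_invariant_set f b (E : set T) : integrable_real f -> measurable E ->
  (mu E < +oo)%E -> (forall x, E x -> E (tau x)) ->
  (forall x, E x -> exists2 n, (0 < n)%N & b < avg (orbit f x) n) ->
  b * fine (mu E) <= \int[mu]_x (f x * \1_E x).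
Proof.
move=> fi mE Eoo invE frE.
have Ii := integrable_indicator mE Eoo.
have fE := integrable_mul_indic mE fi.
pose g x := f x * \1_E x - b * \1_E x.
have gi : integrable_real g.
  by apply: integrable_subr => //; exact: integrable_scaler.
have iterE x k : E x -> E (iter k tau x) by move=> Ex; elim: k => //= k /invE.
suff : 0 <= \int[mu]_x g x.
  rewrite RintegralB//; last exact: integrable_scaler.
  rewrite RintegralZl// subr_ge0.
  by rewrite -[in b * _](fineK (_ : mu E \is a fin_num)) ?ge0_fin_numE// -Rintegral_indic.
pose P n := [set x | 0 < maxsum g n x].
have mP n : measurable (P n).
  by apply: measurable_maxsum_gt0; exact: integrable_measurable gi.
have gP x : (fun n => (g x * \1_(P n) x)%:E) @ \oo --> (g x)%:E.
  apply/fine_cvgP; split; first by apply: nearW.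
  have [Ex|nEx] := pselect (E x); last first.
    rewrite /g /= indicE memNset// !mulr0 subrr.
    by under eq_fun do rewrite mul0r; exact: cvg_cst.
  have [n n0 bn] := frE _ Ex.
  apply: cvg_near_cst; exists n => // m /= nm.
  rewrite indicE mem_set ?mulr1//; rewrite /P/=.
  apply: lt_le_trans (maxsum_homo _ _ nm).
  apply: lt_le_trans (sum_le_maxsum _ n x).
  rewrite -(@ltr_pM2l _ n%:R^-1) ?invr_gt0 ?ltr0n// mulr0.
  rewrite -/(avg (orbit g x) n) (@eq_avg _ _ (fun k => f (iter k tau x) - b)).
    by rewrite avgB avg_cst// subr_gt0.
  by move=> k; rewrite /g indicE mem_set ?mulr1//; exact: iterE.
have [|||||_ _ cv] := @dominated_convergence _ _ _ mu setT measurableT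
  (fun n x => (g x * \1_(P n) x)%:E) (EFin \o g) (fun x => `|(g x)%:E|%E).
- move=> n; apply/measurable_EFinP/measurable_funM => //.
  exact: integrable_measurable gi.
- exact: measurable_int gi.
- by apply: aeW => x _; exact: gP.
- exact: (integrable_normr gi).
- apply: aeW => x n _ /=; rewrite lee_fin normrM ler_piMr//.
  by rewrite indicE; case: (_ \in _); rewrite ?normr1 ?normr0.
have : (0 <= \int[mu]_x (EFin \o g) x)%E.
  rewrite -(cvg_lim _ cv)//; apply: lime_ge; first by apply/cvg_ex; eexists; exact: cv.
  apply: nearW => n /=; have := maximal_ergodic n gi.
  rewrite -lee_fin /Rintegral fineK//.
  exact: (integrable_fin_num measurableT (integrable_mul_indic (mP n) gi)).
by move=> h; exact: fine_ge0.
Qed.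

End maximal.

(** * Upper limits of bounded real sequences *)

Lemma natSinv_lt {R : realType} (e : R) : 0 < e -> exists n : nat, n.+1%:R^-1 < e.
Proof.
move=> e0; have [n _ /(_ n (leqnn n)) /= H] := near_infty_natSinv_lt (PosNum e0).
by exists n.
Qed.

Lemma near_div_le {R : realType} (K e : R) : 0 < e ->
  \forall n \near \oo, K / n%:R <= e.
Proof.
move=> e0; near=> n.
have n0 : (0 < n)%N by near: n; exact: nbhs_infty_gt.
rewrite ler_pdivrMr ?ltr0n// mulrC -ler_pdivrMr//.
by near: n; exact: nbhs_infty_ger.
Unshelve. all: by end_near. Qed.

Section upper_limit.
Context {R : realType}.
Implicit Types (u v : nat -> R) (c C l : R).

(** The upper limit as a real number; it is meaningful for bounded sequences. *)
Definition ulim u : R := fine (limn_esup (EFin \o u)).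

Lemma esup_lt_near u c : (limn_esup (EFin \o u) < c%:E)%E ->
  \forall n \near \oo, u n < c.
Proof.
rewrite /limn_esup limf_esupE => /ereal_inf_lt[_ [A /= Ainf <-] Ac].
apply: filterS Ainf => n An; rewrite -lte_fin; apply: le_lt_trans Ac.
by apply: ereal_sup_ubound; exists n.
Qed.

Lemma near_le_esup u c : (\forall n \near \oo, u n <= c) ->
  (limn_esup (EFin \o u) <= c%:E)%E.
Proof.
move=> uc; rewrite /limn_esup limf_esupE.
apply: (@le_trans _ _ (ereal_sup ((EFin \o u) @` [set n | u n <= c]))).
  by apply: ereal_inf_lbound; exists [set n | u n <= c].
by apply: ge_ereal_sup => _ [n /= un <-]; rewrite lee_fin.
Qed.

Lemma ulimE u C : (forall n, `|u n| <= C) ->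
  (limn_esup (EFin \o u) = (ulim u)%:E)%E.
Proof.
move=> uC; rewrite /ulim fineK//; apply/fin_numPlt; apply/andP; split.
  rewrite ltNge; apply/negP => h.
  have /esup_lt_near : (limn_esup (EFin \o u) < (- C - 1)%:E)%E.
    by apply: (le_lt_trans h); rewrite ltNyr.
  case=> n _ /(_ n (leqnn n)) /=.
  by have := uC n; rewrite ler_norml => /andP[]; lra.
apply: (@le_lt_trans _ _ C%:E); last exact: ltry.
by apply: near_le_esup; apply: nearW => n; have := uC n; rewrite ler_norml => /andP[].
Qed.

Lemma ulim_lt u C c : (forall n, `|u n| <= C) -> ulim u < c ->
  \forall n \near \oo, u n < c.
Proof. by move=> uC uc; apply: esup_lt_near; rewrite (ulimE uC). Qed.

Lemma ulim_le u C c : (forall n, `|u n| <= C) ->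
  (\forall n \near \oo, u n <= c) -> ulim u <= c.
Proof. by move=> uC /near_le_esup; rewrite (ulimE uC). Qed.

Lemma ulim_gt u C c N : (forall n, `|u n| <= C) -> c < ulim u ->
  exists2 n, (N <= n)%N & c < u n.
Proof.
move=> uC cu; apply: contrapT => h.
have : ulim u <= c; last by rewrite leNgt cu.
apply: (ulim_le uC); exists N => // n /= Nn; rewrite leNgt; apply/negP => cn.
by apply: h; exists n.
Qed.

Lemma ulim_le_near u v C : (forall n, `|u n| <= C) -> (forall n, `|v n| <= C) ->
  (forall e, 0 < e -> \forall n \near \oo, u n <= v n + e) -> ulim u <= ulim v.
Proof.
move=> uC vC uv; apply/ler_addgt0Pr => e e0.
apply: (ulim_le uC).
have e20 : 0 < e / 2 by rewrite divr_gt0.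
have vlt : ulim v < ulim v + e / 2 by rewrite ltrDl.
near=> n.
have h1 : u n <= v n + e / 2 by near: n; exact: uv.
have h2 : v n < ulim v + e / 2 by near: n; exact: (ulim_lt vC vlt).
lra.
Unshelve. all: by end_near. Qed.

Lemma ulim_le_add u v C e :
  (forall n, `|u n| <= C) -> (forall n, `|v n| <= C) ->
  (forall n, u n <= v n + e) -> ulim u <= ulim v + e.
Proof.
move=> uC vC uv; apply/ler_addgt0Pr => r r0; apply: (ulim_le uC).
have lt : ulim v < ulim v + r by rewrite ltrDl.
have vlt := ulim_lt vC lt.
near=> n; have : v n < ulim v + r by near: n.
by have := uv n; lra.
Unshelve. all: by end_near. Qed.

Lemma ulim_eq u v C : (forall n, `|u n| <= C) -> (forall n, `|v n| <= C) ->
  (fun n => u n - v n) @ \oo --> (0 : R) -> ulim u = ulim v.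
Proof.
move=> uC vC /cvgrPdist_le uv; apply/eqP; rewrite eq_le.
apply/andP; split; apply: (@ulim_le_near _ _ C) => // e e0; near=> n;
  have : `|0 - (u n - v n)| <= e by near: n; exact: uv.
- by rewrite sub0r normrN ler_norml => /andP[]; lra.
- by rewrite sub0r normrN ler_norml => /andP[]; lra.
Unshelve. all: by end_near. Qed.

Lemma ulim_cvg u C : (forall n, `|u n| <= C) ->
  ulim u + ulim (fun n => - u n) <= 0 -> u @ \oo --> ulim u.
Proof.
move=> uC s0; have nuC n : `|- u n| <= C by rewrite normrN.
apply/cvgrPdist_le => e e0.
have h1 : ulim u < ulim u + e by rewrite ltrDl.
have h2 : ulim (fun n => - u n) < ulim (fun n => - u n) + e by rewrite ltrDl.
have n1 := ulim_lt uC h1; have n2 := ulim_lt nuC h2.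
near=> n; rewrite ler_norml.
have g1 : u n < ulim u + e by near: n.
have g2 : - u n < ulim (fun n => - u n) + e by near: n.
lra.
Unshelve. all: by end_near. Qed.

End upper_limit.

(** * The pointwise ergodic theorem for bounded integrable functions *)

Section birkhoff.
Context d (T : measurableType d) (R : realType).
Variables (mu : {measure set T -> \bar R}) (tau : T -> T).
Hypothesis htau : measure_preserving mu tau.
Implicit Types (f g u : T -> R).

Notation integrable_real f := (mu.-integrable [set: T] (EFin \o f)).
Notation orbit f x := (fun k => f (iter k tau x)).

Let mtau : measurable_fun setT tau := htau.1.

Definition upper_average f x : R := ulim (avg (orbit f x)).

Lemma measurable_iter k : measurable_fun setT (iter k tau).
Proof.
elim: k => [|k IH]; first exact: measurable_id.
exact: (measurableT_comp mtau IH).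
Qed.

Lemma measurable_avg f n : measurable_fun setT f ->
  measurable_fun setT (fun x => avg (orbit f x) n).
Proof.
move=> mf; apply: measurable_funM => //; apply: measurable_sum => k.
by apply: measurableT_comp => //; exact: measurable_iter.
Qed.

Lemma measurable_upper_average f : measurable_fun setT f ->
  measurable_fun setT (upper_average f).
Proof.
move=> mf; apply: measurableT_comp => //.
apply: measurable_fun_limn_esup => n; apply/measurable_EFinP.
exact: measurable_avg.
Qed.

(** The averages at [x] and [tau x] differ by O(1/n). *)
Lemma upper_average_invariant f C x : (forall x, `|f x| <= C) ->
  upper_average f (tau x) = upper_average f x.
Proof.
move=> fC; have C0 : 0 <= C by exact: le_trans (fC x).
apply: (@ulim_eq _ _ _ C) => [n|n|]; try by apply: avg_bounded.
apply/cvgrPdist_le => e e0; near=> n; rewrite sub0r normrN.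
rewrite (@eq_avg _ _ (fun k => f (iter (k + 1) tau x))); last first.
  by move=> k; rewrite addn1 iterSr.
rewrite (le_trans (@avg_shift _ (orbit f x) C 1 n _))// mul1r.
by near: n; exact: near_div_le.
Unshelve. all: by end_near. Qed.

Lemma upper_average_gt f C x c : (forall x, `|f x| <= C) ->
  c < upper_average f x -> exists2 n, (0 < n)%N & c < avg (orbit f x) n.
Proof.
by move=> fC; apply: ulim_gt => n; apply: avg_bounded => k; exact: fC.
Qed.

(** The set of such points is invariant.  Call it E; it has finite measure by the maximal inequality
    for |f|, since either b > 0 or -a > 0.  The maximal ergodic theorem for
    f - b and for a - f on E yields b mu(E) <= int_E f <= a mu(E). *)
Lemma crossing_null f C (a b : R) : integrable_real f -> (forall x, `|f x| <= C) ->
  a < b ->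
  mu [set x | b < upper_average f x /\ - a < upper_average (fun x => - f x) x] = 0%E.
Proof.
move=> fi fC ab; set E := [set x | _].
have nfC x : `|- f x| <= C by rewrite normrN.
have nfi := integrable_oppr fi.
have mf := integrable_measurable fi.
have mE : measurable E.
  apply: measurableI; apply: measurable_set_ltr => //; apply: measurable_upper_average => //.
  exact: integrable_measurable nfi.
have invE x : E x -> E (tau x).
  by rewrite /E /= (upper_average_invariant _ fC) (upper_average_invariant _ nfC).
have absi := integrable_normr fi.
have Eoo : (mu E < +oo)%E.
  have H c g : 0 < c -> (forall x, g x <= `|f x|) -> (forall x, `|g x| <= C) ->
      E `<=` [set x | c < upper_average g x] -> (mu E < +oo)%E.
    move=> c0 gf gC Ec.
    apply: (@le_lt_trans _ _ (mu (maximal_set tau (fun x => `|f x|) c))).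
      apply: le_measure; rewrite ?inE//.
        by have := measurable_maximal_set htau c (integrable_measurable absi).
      move=> x /Ec /= /(upper_average_gt gC)[n n0 cn].
      apply: (maximal_setP n0); apply: lt_le_trans cn _.
      exact: ler_avg.
    apply: le_lt_trans (maximal_inequality htau absi _ c0) _ => //.
    exact: ltry.
  have [b0|b0] := ltP 0 b.
    apply: (H b f) => // [x|x []//]; exact: ler_norm.
  apply: (H (- a) (fun x => - f x)) => //; first by lra.
    by move=> x; rewrite -normrN ler_norm.
  by move=> x [].
have h1 : b * fine (mu E) <= \int[mu]_x (f x * \1_E x).
  by apply: (maximal_ergodic_invariant_set htau fi) => // x [+ _] => /(upper_average_gt fC).
have h2 : - a * fine (mu E) <= \int[mu]_x (- f x * \1_E x).
  by apply: (maximal_ergodic_invariant_set htau nfi) => // x [_] => /(upper_average_gt nfC).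
have h3 : \int[mu]_x (- f x * \1_E x) = - \int[mu]_x (f x * \1_E x).
  under eq_Rintegral do rewrite mulNr -mulN1r.
  by rewrite RintegralZl ?mulN1r//; exact: integrable_mul_indic.
have E0 : fine (mu E) <= 0.
  rewrite -(@pmulr_rle0 _ (b - a)) ?subr_gt0// mulrBl.
  by lra.
have := fine_ge0 (measure_ge0 mu E) => E1.
apply/eqP; rewrite -[mu E]fineK ?ge0_fin_numE// eqe eq_le E0 E1//.
Qed.

(** Off the countably many crossing sets with rational endpoints, the upper and
    lower limits of the averages agree. *)
Theorem birkhoff_bounded f C : integrable_real f -> (forall x, `|f x| <= C) ->
  {ae mu, forall x, avg (orbit f x) @ \oo --> upper_average f x}.
Proof.
move=> fi fC.
have H (p : rat * rat) : {ae mu, forall x, p.1 < p.2 ->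
    ~ (ratr p.2 < upper_average f x /\
       - ratr p.1 < upper_average (fun x => - f x) x)}.
  have [lt|nlt] := boolP (p.1 < p.2); last by apply: aeW.
  have := @crossing_null f C (ratr p.1) (ratr p.2) fi fC.
  rewrite ltr_rat => /(_ lt) mu0.
  have nfi := integrable_oppr fi.
  exists [set x | ratr p.2 < upper_average f x /\
                  - ratr p.1 < upper_average (fun x => - f x) x]; split => //.
    apply: measurableI; apply: measurable_set_ltr => //; apply: measurable_upper_average => //.
      exact: integrable_measurable fi.
    exact: integrable_measurable nfi.
  by move=> x /= /existsNP[_ /contrapT].
pose q n : rat * rat := odflt (0, 0) (unpickle n).
have /ae_foralln K := fun n => H (q n).
apply: filterS K => x Hx.
have uC n : `|avg (orbit f x) n| <= C by apply: avg_bounded => k; exact: fC.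
apply: (ulim_cvg uC); rewrite leNgt; apply/negP => h.
have E : ulim (fun n => - avg (orbit f x) n) = upper_average (fun x => - f x) x.
  by congr ulim; apply/funext => n; rewrite avgN.
rewrite E -/(upper_average f x) in h.
set u := upper_average f x in h; set v := upper_average (fun x => - f x) x in h.
have /rat_in_itvoo[b] : - v < u by lra.
rewrite in_itv /= => /andP[b1 b2].
have /rat_in_itvoo[a] := b1; rewrite in_itv /= => /andP[a1 a2].
have := Hx (pickle (a, b)); rewrite /q pickleK /=; apply.
  by move: a2; rewrite ltr_rat.
by split => //; rewrite ltrNl.
Qed.

End birkhoff.

(** * Skew products with the circle *)

Section circle_rotation.
Context {R : realType}.
Implicit Types (c s t a : R) (A B : set R).

Notation leb := (@lebesgue_measure R).

Lemma measurable_addr a : measurable_fun setT (fun t : measurableTypeR R => t + a).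
Proof. by apply: measurable_funD. Qed.

Lemma lebesgue_measure_translation a (A : set (measurableTypeR R)) : measurable A ->
  leb ((fun t => t + a) @^-1` A) = leb A.
Proof.
move=> mA; have ma := measurable_addr a.
change (pushforward leb ((fun t => t + a) : _ -> measurableTypeR R) A = leb A).
apply/esym/lebesgue_measure_unique => //= _ [[x y]] _ <-.
rewrite /pushforward [X in _ = leb X](_ : _ = `]x - a, y - a]%classic).
  rewrite !lebesgue_measure_itv/= !lte_fin ltrD2r; case: ifP => // _.
  by rewrite -!EFinB; congr EFin; ring.
by apply/seteqP; split => t /=; rewrite !in_itv /= => /andP[h1 h2]; apply/andP;
  split; lra.
Qed.

(** Rotation by [s] of the circle [0, c[, extended by the identity so that it
    preserves Lebesgue measure on the whole line. *)
Definition circle_rot c s t : R :=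
  if (0 <= t) && (t < c) then if t + s < c then t + s else t + s - c else t.

(** The rotation is the identity outside [0, c[ and exchanges two subintervals
    of [0, c[ by translations. *)
Lemma lebesgue_measure_circle_rot c s (A : set (measurableTypeR R)) : 0 <= s < c ->
  measurable A -> leb (circle_rot c s @^-1` A) = leb A.
Proof.
move=> /andP[s0 sc] mA.
pose O := A `&` ~` `[0, c[%classic.
pose P := A `&` `[s, c[%classic; pose Q := A `&` `[0, s[%classic.
have mO : measurable O by apply: measurableI => //; exact: measurableC.
have mP : measurable P by apply: measurableI.
have mQ : measurable Q by apply: measurableI.
have mt a B : measurable B -> measurable ((fun t : measurableTypeR R => t + a) @^-1` B).
  by move=> mB; rewrite -[X in measurable X]setTI; apply: measurable_addr.
have E1 : A = O `|` (P `|` Q).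
  apply/seteqP; split => t /=.
    move=> At; have [tc|tc] := boolP (t \in `[0, c[); last by left; split => //; exact/negP.
    right; move: tc; rewrite in_itv /= => /andP[t0 tc]; have [ts|ts] := ltP t s.
      by right; split => //=; rewrite in_itv/= t0.
    by left; split => //=; rewrite in_itv/= ts.
  by case=> [[]|[[]|[]]].
have E2 : circle_rot c s @^-1` A = O `|`
    ((fun t => t + s) @^-1` P `|` (fun t => t + (s - c)) @^-1` Q).
  apply/seteqP; split => t /=; rewrite /circle_rot.
    have [tc|tc] := boolP ((0 <= t) && (t < c)); last first.
      by move=> At; left; split => //=; rewrite in_itv/=; exact/negP.
    move: tc => /andP[t0 tc]; case: ltP => h At; right.
      by left; split => //=; rewrite in_itv/= h andbT; lra.
    right; split => //=; first by rewrite addrA.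
    by rewrite in_itv/=; apply/andP; split; lra.
  case=> [[At]|[[At]|[At]]] /=; rewrite in_itv/=.
  - by move=> /negP/negbTE ->.
  - move=> /andP[h1 h2]; rewrite h2.
    have -> : 0 <= t by lra.
    by have -> : t < c by lra.
  - move=> /andP[h1 h2].
    have -> : 0 <= t by lra.
    have -> /= : t < c by lra.
    have -> : (t + s < c) = false by apply/negbTE; rewrite -leNgt; lra.
    by rewrite -addrA.
have PQ : P `&` Q = set0.
  apply/seteqP; split => t //= [[_]] /=; rewrite in_itv/= => /andP[h1 h2] [_] /=.
  by rewrite in_itv/= => /andP[h3 h4]; lra.
have OPQ : O `&` (P `|` Q) = set0.
  apply/seteqP; split => t //= [[_]] /=; rewrite in_itv/= => h [] [_] /=;
    rewrite in_itv/= => /andP[h1 h2]; apply: h; apply/andP; split; lra.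
have PQ' : (fun t => t + s) @^-1` P `&` (fun t => t + (s - c)) @^-1` Q = set0.
  apply/seteqP; split => t //= [[_]] /=; rewrite in_itv/= => /andP[h1 h2] [_] /=.
  by rewrite in_itv/= => /andP[h3 h4]; lra.
have OPQ' : O `&` ((fun t => t + s) @^-1` P `|` (fun t => t + (s - c)) @^-1` Q) = set0.
  apply/seteqP; split => t //= [[_]] /=; rewrite in_itv/= => h [] [_] /=;
    rewrite in_itv/= => /andP[h1 h2]; apply: h; apply/andP; split; lra.
have mPQ := measurableU _ _ mP mQ.
have mP' := mt s _ mP; have mQ' := mt (s - c) _ mQ.
have mPQ' := measurableU _ _ mP' mQ'.
rewrite [in RHS]E1 E2 !measureU//.
by congr (_ + (_ + _))%E; exact: lebesgue_measure_translation.
Qed.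

End circle_rotation.

Section skew_product.
Context d (T : measurableType d) (R : realType).
Variables (mu : {sigma_finite_measure set T -> \bar R}) (tau : T -> T).
Hypothesis htau : measure_preserving mu tau.
Variable theta : T -> R.
Hypothesis mtheta : measurable_fun setT theta.
Hypothesis theta_range : forall x, 0 <= theta x < 2 * pi.
Hypothesis theta_inv : forall x, theta (tau x) = theta x.

Notation leb := (@lebesgue_measure R).
Notation X := (T * measurableTypeR R)%type.
Notation integrable_real m f := (m.-integrable setT (EFin \o f)).

Let mtau : measurable_fun setT tau := htau.1.

Definition skew_map (z : X) : X := (tau z.1, circle_rot (2 * pi) (theta z.1) z.2).

Lemma measurable_skew_map : measurable_fun setT skew_map.
Proof.
have m2 : measurable_fun setT (snd : X -> measurableTypeR R) := measurable_snd.
have mth : measurable_fun setT (fun z : X => theta z.1).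
  exact: measurableT_comp mtheta measurable_fst.
apply: measurable_fun_pair; first exact: measurableT_comp mtau measurable_fst.
rewrite /circle_rot; apply: measurable_fun_ifT => //.
  by apply: measurable_and; [exact: measurable_fun_ler | exact: measurable_fun_ltr].
have md : measurable_fun setT (fun z : X => (z.2 : R) + theta z.1).
  exact: measurable_funD.
apply: measurable_fun_ifT => //; first exact: measurable_fun_ltr.
exact: measurable_funB.
Qed.

(** The product measure of a set is the integral of the measures of its sections;
    the section at [x] of the preimage is the section at [tau x] rotated back by
    [theta x], and [tau] preserves [mu]. *)
Lemma skew_map_preserving : measure_preserving (mu \x leb)%E skew_map.
Proof.
split; first exact: measurable_skew_map.
move=> A mA; rewrite /product_measure1.
transitivity (\int[mu]_x (leb \o xsection A) (tau x))%E.
  apply: eq_integral => x _ /=.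
  rewrite -(lebesgue_measure_circle_rot (theta_range x) (measurable_xsection (tau x) mA)).
  by congr (leb _); apply/seteqP; split => t /=; rewrite /xsection /= !inE.
rewrite (ge0_integral_comp_preserving htau)//.
exact: measurable_fun_xsection.
Qed.

Lemma ae_product_section (P : X -> Prop) : {ae (mu \x leb)%E, forall z, P z} ->
  {ae mu, forall x, exists2 t, 0 <= t < 2 * pi & P (x, t)}.
Proof.
move=> [N [mN N0 PN]].
have mN' : measurable_fun setT (leb \o xsection N) by exact: measurable_fun_xsection.
have : (\int[mu]_x `|(leb \o xsection N) x| = 0)%E.
  by rewrite -[RHS]N0; apply: eq_integral => x _; rewrite gee0_abs.
move/(ae_eq_integral_abs mu measurableT mN'); apply: filterS => x /(_ I) /= Nx0.
apply: contrapT => h.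
have : (leb `[0%R, (2 * pi)%R[ <= leb (xsection N x))%E.
  apply: le_measure; rewrite ?inE//; first exact: measurable_xsection.
  move=> t /=; rewrite in_itv/= => t02; apply/xsectionP; apply: PN => /= Pxt.
  by apply: h; exists t.
rewrite Nx0 lebesgue_measure_itv/= lte_fin mulr_gt0 ?pi_gt0//.
by rewrite -EFinB lee_fin subr0 leNgt mulr_gt0 ?pi_gt0.
Qed.

Variables (f : T -> R) (C : R).
Hypothesis fi : integrable_real mu f.
Hypothesis fC : forall x, `|f x| <= C.

Let twist (g : R -> R) (z : X) : R := f z.1 * (g z.2 * \1_`[0, 2 * pi[ z.2).

Lemma integrable_twist (g : R -> R) : measurable_fun setT g -> (forall t, `|g t| <= 1) ->
  integrable_real (mu \x leb)%E (twist g).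
Proof.
move=> mg g1; have mf := integrable_measurable fi.
pose h t := g t * \1_`[0, 2 * pi[ t.
have hi : integrable_real leb h.
  have Ii := @integrable_indic_itv R 0 (2 * pi) true true.
  apply: (@integrable_le _ (measurableTypeR R) _ leb h _ _ _ Ii).
  - by apply: measurable_funM => //; exact: measurable_indic.
  - by move=> t; rewrite normrM ler_piMl.
have mh := integrable_measurable hi.
have mt : measurable_fun setT (twist g).
  apply: measurable_funM; first exact: measurableT_comp mf measurable_fst.
  exact: measurableT_comp mh measurable_snd.
apply/integrable12ltyP; first exact/measurable_EFinP.
have E x : (\int[leb]_y `|(EFin \o twist g) (x, y)| =
    `|f x|%:E * \int[leb]_y `|(h y)%:E|)%E.
  rewrite -ge0_integralZl_EFin//; last first.
    by apply: measurableT_comp => //; exact/measurable_EFinP.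
  by apply: eq_integral => y _ /=; rewrite /twist /= normrM EFinM.
under eq_integral do rewrite E.
rewrite ge0_integralZr//; last 2 first.
- by apply/measurable_EFinP; exact: measurableT_comp.
- exact: integral_ge0.
rewrite lte_mul_pinfty//.
- exact: integral_ge0.
- have /integrableP[_] := fi; rewrite ge0_fin_numE//.
  exact: integral_ge0.
- by have /integrableP[] := hi.
Qed.

Lemma skew_map_orbit x t k : 0 <= t < 2 * pi ->
  [/\ (iter k skew_map (x, t)).1 = iter k tau x,
      0 <= (iter k skew_map (x, t)).2 < 2 * pi,
      cos (iter k skew_map (x, t)).2 = cos (k%:R * theta x + t) &
      sin (iter k skew_map (x, t)).2 = sin (k%:R * theta x + t)].
Proof.
move=> t02; elim: k => [|k [IH1 IH2 IH3 IH4]]; first by rewrite mul0r add0r.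
rewrite iterS /skew_map /= IH1; set u := (iter k _ _).2 in IH2 IH3 IH4 *.
have thk : theta (iter k tau x) = theta x.
  by elim: k {IH1 IH3 IH4 u IH2} => //= k IH; rewrite theta_inv.
rewrite thk /circle_rot IH2.
have := theta_range x => thx.
have E : [/\ cos (u + theta x) = cos (k.+1%:R * theta x + t) &
             sin (u + theta x) = sin (k.+1%:R * theta x + t)].
  rewrite cosD sinD IH3 IH4 -cosD -sinD -natr1 mulrDl mul1r.
  by rewrite addrAC.
case: E => E1 E2.
have P2 (y : R) : cos (y - 2 * pi) = cos y /\ sin (y - 2 * pi) = sin y.
  rewrite -{2 4}(subrK (2 * pi) y) (mulr_natl pi 2).
  by rewrite cosD2pi sinD2pi.
case: ltP => h; split => //; try lra.
- by rewrite (P2 _).1.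
- by rewrite (P2 _).2.
Qed.

(** Along the orbit of (x, t) under the skew product, f(x) cos(t) takes the
    values f(tau^k x) cos(k theta(x) + t).  Almost every [x] has some [t] for
    which the averages of these and of the corresponding sines converge, and
    the addition formula then gives every other phase. *)
Lemma twisted_birkhoff : {ae mu, forall x t,
  cvg (avg (fun k => cos (k%:R * theta x + t) * f (iter k tau x)) @ \oo)}.
Proof.
have B (g : R -> R) : measurable_fun setT g -> (forall t, `|g t| <= 1) ->
    {ae (mu \x leb)%E, forall z, cvg (avg (fun k => twist g (iter k skew_map z)) @ \oo)}.
  move=> mg g1.
  have : {ae (mu \x leb)%E, forall z, avg (fun k => twist g (iter k skew_map z)) @ \oo -->
      upper_average skew_map (twist g) z}.
    apply: (birkhoff_bounded (C := C) skew_map_preserving (integrable_twist mg g1)) => z.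
    rewrite normrM -[leRHS]mulr1 ler_pM// normrM -[leRHS]mulr1 ler_pM//.
    by rewrite indicE; case: (_ \in _); rewrite ?normr1 ?normr0.
  by apply: filterS => z zc; apply/cvg_ex; eexists; exact: zc.
have mcos : measurable_fun setT (@cos R).
  by apply: continuous_measurable_fun; exact: continuous_cos.
have msin : measurable_fun setT (@sin R).
  by apply: continuous_measurable_fun; exact: continuous_sin.
have : {ae (mu \x leb)%E, forall z,
    cvg (avg (fun k => twist cos (iter k skew_map z)) @ \oo) /\
    cvg (avg (fun k => twist sin (iter k skew_map z)) @ \oo)}.
  by apply: filterI; [exact: (B _ mcos (@cos_max R)) | exact: (B _ msin (@sin_max R))].
move=> /ae_product_section H; apply: filterS H => x [t t02 [/= cvc cvs]] t'.
have in02 k : (iter k skew_map (x, t)).2 \in `[0, 2 * pi[%classic.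
  by rewrite inE /= in_itv/=; have [] := skew_map_orbit x k t02.
have Ec : avg (fun k => twist cos (iter k skew_map (x, t))) =
    avg (fun k => cos (k%:R * theta x + t) * f (iter k tau x)).
  apply/funext => n; apply: eq_avg => k; have [h1 _ h3 _] := skew_map_orbit x k t02.
  by rewrite /twist indicE in02 h1 h3 mulr1 mulrC.
have Es : avg (fun k => twist sin (iter k skew_map (x, t))) =
    avg (fun k => sin (k%:R * theta x + t) * f (iter k tau x)).
  apply/funext => n; apply: eq_avg => k; have [h1 _ _ h3] := skew_map_orbit x k t02.
  by rewrite /twist indicE in02 h1 h3 mulr1 mulrC.
rewrite Ec in cvc; rewrite Es in cvs.
have -> : avg (fun k => cos (k%:R * theta x + t') * f (iter k tau x)) = (fun n =>
    cos (t' - t) * avg (fun k => cos (k%:R * theta x + t) * f (iter k tau x)) n -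
    sin (t' - t) * avg (fun k => sin (k%:R * theta x + t) * f (iter k tau x)) n).
  apply/funext => n; rewrite -!avgZ -avgB; apply: eq_avg => k.
  have -> : k%:R * theta x + t' = (k%:R * theta x + t) + (t' - t) by lra.
  by rewrite (cosD (k%:R * theta x + t) (t' - t)); ring.
by apply: is_cvgB; apply: is_cvgMr.
Qed.

End skew_product.

(** * Selecting the first exceptional frequency *)

Section first_hit.
Context {R : realType}.
Implicit Types (l : nat -> R -> R) (delta p t theta : R).

(** For continuous [l h], this says that no frequency in [p, t] has all its values
    [l h] at least [delta]; only rational arguments and countable operations
    occur, which makes the first such frequency measurable in a parameter of
    [l]. *)
Definition avoids l delta p t : Prop :=
  exists n : nat, forall q : rat, p <= ratr q <= t ->
    exists2 h, (h <= n)%N & l h (ratr q) <= delta - n.+1%:R^-1.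

(** The rational numbers are enumerated by [unpickle]; those that do not qualify
    are replaced by the lower end [p] of the search. *)
Definition candidate l delta p m (n : nat) : R :=
  let q := ratr (odflt 0 (unpickle n)) in
  if `[< p <= q <= m /\ avoids l delta p q >] then q else p.

Definition first_hit l delta p m : R := sups (candidate l delta p m) 0.

Lemma candidate_range l delta p m n : p <= m -> p <= candidate l delta p m n <= m.
Proof. by rewrite /candidate; case: asboolP => [[]//|_ ->]; rewrite lexx. Qed.

Lemma candidate_ubound l delta p m : p <= m ->
  ubound (range (candidate l delta p m)) m.
Proof. by move=> pm _ [n _ <-]; have /andP[] := @candidate_range l delta p m n pm. Qed.

Lemma first_hitE l delta p m :
  first_hit l delta p m = sup (range (candidate l delta p m)).
Proof.
rewrite /first_hit /sups /=; congr sup.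
by apply/seteqP; split => _ [n _ <-]; exists n.
Qed.

Lemma first_hit_range l delta p m : p <= m -> p <= first_hit l delta p m <= m.
Proof.
move=> pm; have ub := @candidate_ubound l delta p m pm; rewrite first_hitE; apply/andP; split.
  have /andP[+ _] := @candidate_range l delta p m 0 pm; move=> /le_trans; apply.
  by apply: ub_le_sup; [exists m | exists 0%N].
by apply: ge_sup => //; exists (candidate l delta p m 0); exists 0%N.
Qed.

(** By compactness of [p, t]: otherwise a limit point of rational witnesses
    would have all its values at least [delta]. *)
Lemma avoids_below l delta p t : (forall h, continuous (l h)) -> p <= t ->
  (forall theta, p <= theta <= t -> exists h, l h theta < delta) ->
  avoids l delta p t.
Proof.
move=> lc pt H; apply: contrapT => /forallNP na.
have {na} na n : exists q : rat, p <= ratr q <= t /\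
    forall h, (h <= n)%N -> delta - n.+1%:R^-1 < l h (ratr q).
  have /existsNP[q /not_implyP[qpt nq]] := na n.
  exists q; split => // h hn; rewrite ltNge; apply/negP => lh.
  by apply: nq; exists h.
have [q qP] := choice na.
have cpt := @segment_compact R p t.
have [|theta [thpt cl]] := cpt ((fun n => ratr (q n) : R) @ \oo) _.
  by exists 0%N => // n _ /=; rewrite in_itv/=; have [] := qP n.
have [h lh] := H theta thpt.
pose eta := (delta - l h theta) / 2.
have eta0 : 0 < eta by rewrite divr_gt0// subr_gt0.
have [N NP] := natSinv_lt eta0.
have nb : nbhs theta [set y | l h y < delta - eta].
  have lt1 : l h theta < delta - eta by rewrite /eta; lra.
  exact: (lc h theta _ (lt_nbhsl lt1)).
have ev : ((fun n => ratr (q n) : R) @ \oo)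
    [set y | exists2 n, (maxn h N <= n)%N & y = ratr (q n)].
  by exists (maxn h N) => // n /= hn; exists n.
have [_ [[n hn ->] /= lq]] := cl _ _ ev nb.
have [_ /(_ h)] := qP n.
rewrite (leq_trans _ hn) ?leq_maxl// => /(_ isT).
have : n.+1%:R^-1 <= N.+1%:R^-1 :> R.
  by rewrite lef_pV2 ?posrE ?ltr0n// ler_nat ltnS (leq_trans _ hn) ?leq_maxr.
move=> h1 /lt_trans/(_ lq); rewrite ltrD2l ltrN2.
by move=> /lt_le_trans/(_ h1)/lt_trans/(_ NP); rewrite ltxx.
Qed.

Lemma not_avoids_above l delta p t theta : (forall h, continuous (l h)) ->
  p < theta <= t -> (forall h, delta <= l h theta) -> ~ avoids l delta p t.
Proof.
move=> lc /andP[pth tht] H [n Hn].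
have P h : \forall y \near theta, delta - n.+1%:R^-1 < l h y.
  have gt1 : delta - n.+1%:R^-1 < l h theta.
    by rewrite (lt_le_trans _ (H h))// gtrBl invr_gt0 ltr0n.
  exact: (lc h theta _ (lt_nbhsr gt1)).
have : \forall y \near theta, forall h : 'I_n.+1, delta - n.+1%:R^-1 < l h y.
  exact: (@filter_forall R 'I_n.+1 (fun h => [set y | delta - n.+1%:R^-1 < l h y])
    (nbhs theta) _ (fun h => P h)).
move=> /nbhs_ballP[e /= e0 eP].
have : Num.max p (theta - e) < theta by rewrite gt_max pth gtrBl e0.
move=> /rat_in_itvoo[q]; rewrite in_itv/= gt_max => /andP[/andP[pq eq] qth].
have [|h hn] := Hn q; first by rewrite (ltW pq) (le_trans (ltW qth)).
have := eP (ratr q) _ (Ordinal (hn : (h < n.+1)%N)); rewrite leNgt /= => -> //.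
by rewrite /ball/= ger0_norm ?subr_ge0 ?ltW//; lra.
Qed.

(** The rational numbers in [p, theta[ qualify as candidates, by compactness, and
    those from [theta] on do not, by continuity to the left of [theta]. *)
Lemma first_hit_eq l delta p m theta : (forall h, continuous (l h)) ->
  p < theta <= m -> (forall h, delta <= l h theta) ->
  (forall y, p <= y < theta -> exists h, l h y < delta) ->
  first_hit l delta p m = theta.
Proof.
move=> lc /andP[pth thm] Hth Hy; have pm : p <= m by rewrite (le_trans (ltW pth)).
rewrite first_hitE.
apply/eqP; rewrite eq_le; apply/andP; split.
  apply: ge_sup; first by exists (candidate l delta p m 0); exists 0%N.
  move=> _ [n _ <-]; rewrite /candidate; case: asboolP => [[/andP[pq qm] av]|_].
    rewrite leNgt; apply/negP => thq.
    by apply: (not_avoids_above lc _ Hth av); rewrite pth ltW.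
  exact: ltW.
rewrite leNgt; apply/negP => sth.
have : Num.max p (sup (range (candidate l delta p m))) < theta by rewrite gt_max pth.
move=> /rat_in_itvoo[q]; rewrite in_itv/= gt_max => /andP[/andP[pq sq] qth].
move: sq; apply/negP; rewrite -leNgt.
apply: ub_le_sup; first by exists m; exact: candidate_ubound.
exists (pickle q) => //; rewrite /candidate pickleK /=; case: asboolP => // -[]; split.
  by rewrite (ltW pq) (le_trans (ltW qth)).
apply: avoids_below => //; first exact: ltW.
by move=> y /andP[py yq]; apply: Hy; rewrite py (le_lt_trans yq).
Qed.

End first_hit.

(** * The Wiener-Wintner theorem *)

Section wiener_wintner.
Context d (T : measurableType d) (R : realType).
Variables (mu : {sigma_finite_measure set T -> \bar R}) (tau : T -> T).
Hypothesis htau : measure_preserving mu tau.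
Variables (f : T -> R) (C : R).
Hypothesis fi : mu.-integrable setT (EFin \o f).
Hypothesis fC : forall x, `|f x| <= C.

Notation integrable_real f := (mu.-integrable [set: T] (EFin \o f)).
Notation orbit f x := (fun k => f (iter k tau x)).

Let C0 (x : T) : 0 <= C. Proof. exact: le_trans (fC x). Qed.

Definition orbit_power H theta (x : T) : R := window_power H theta (orbit f x).

Lemma orbit_power_iter H theta k x :
  orbit_power H theta (iter k tau x) = window_power H theta (fun j => f (iter (k + j) tau x)).
Proof. by rewrite /orbit_power; congr window_power; apply/funext => j; rewrite -iterD addnC. Qed.

Lemma orbit_power_le H theta x : `|orbit_power H theta x| <= 2 * C ^+ 2.
Proof. by rewrite ger0_norm ?window_power_ge0//; apply: window_power_le => j; exact: fC. Qed.

Lemma integrable_avg (h : nat -> T -> R) n : (forall j, integrable_real (h j)) ->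
  integrable_real (fun x => avg (fun j => h j x) n).
Proof.
move=> hi; apply: integrable_scaler.
elim: n => [|n IH].
  apply: (eq_integrable measurableT (cst 0%E)); last exact: integrable0.
  by move=> x _ /=; rewrite big_nil.
apply: (eq_integrable measurableT (EFin \o (fun x => \sum_(0 <= k < n) h k x + h n x))).
  by move=> x _ /=; rewrite big_nat_recr.
exact: integrable_addr.
Qed.

Lemma integrable_orbit_power H theta : integrable_real (orbit_power H theta).
Proof.
have W (g : R -> R) : (forall t, `|g t| <= 1) -> integrable_real
    (fun x => avg (fun j => g (j%:R * theta) * f (iter j tau x)) H ^+ 2).
  move=> g1.
  have wi : integrable_real (fun x => avg (fun j => g (j%:R * theta) * f (iter j tau x)) H).
    apply: integrable_avg => j; apply: integrable_scaler.
    exact: integrable_iter.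
  apply: (integrable_le _ _ (integrable_scaler C wi)).
    by apply: measurable_funX; exact: integrable_measurable wi.
  move=> x; rewrite expr2 normrM [leRHS]normrM ler_wpM2r// (ger0_norm (C0 x)).
  apply: avg_bounded => j; rewrite normrM -[leRHS]mul1r ler_pM//; exact: fC.
by apply: integrable_addr; apply: W; [exact: cos_max | exact: sin_max].
Qed.

(** The limit of the window powers along the orbit, where it exists; as an upper
    limit it is defined, continuous in [theta] and exactly invariant under [tau]
    at every point. *)
Definition mean_power H theta (x : T) : R := upper_average tau (orbit_power H theta) x.

Let orbit_power_avg_le H theta x n : `|avg (orbit (orbit_power H theta) x) n| <= 2 * C ^+ 2.
Proof. by apply: avg_bounded => k; exact: orbit_power_le. Qed.

Let lip H : R := 4 * H%:R * C ^+ 2.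

Let orbit_power_avg_lipschitz H theta theta' x n :
  avg (orbit (orbit_power H theta) x) n <=
  avg (orbit (orbit_power H theta') x) n + lip H * `|theta - theta'|.
Proof.
rewrite -lerBlDl -avgB (le_trans (ler_norm _))//; apply: avg_bounded => k.
by apply: window_power_lipschitz => j; exact: fC.
Qed.

Lemma mean_power_lipschitz H theta theta' x :
  mean_power H theta x <= mean_power H theta' x + lip H * `|theta - theta'|.
Proof.
by apply: ulim_le_add => // n; exact: orbit_power_avg_le.
Qed.

Lemma mean_power_continuous H x : continuous (mean_power H ^~ x).
Proof.
move=> theta; apply/cvgrPdist_le => e e0.
have L0 : 0 <= lip H by rewrite /lip mulr_ge0 ?sqr_ge0// mulr_ge0.
have L1 : 0 < lip H + 1 by rewrite ltr_wpDl.
near=> y.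
have : `|theta - y| <= e / (lip H + 1).
  by near: y; apply: cvgr_dist_le => //; exact: divr_gt0.
rewrite ler_pdivlMr// => h.
have h' : lip H * `|theta - y| <= e.
  by rewrite (le_trans _ h)// mulrC ler_wpM2l// lerDl.
have h1 := mean_power_lipschitz H theta y x.
have h2 := mean_power_lipschitz H y theta x.
rewrite (distrC y) in h2.
by rewrite ler_norml; lra.
Unshelve. all: by end_near. Qed.

Lemma mean_power_invariant H theta x : mean_power H theta (tau x) = mean_power H theta x.
Proof. exact: (@upper_average_invariant _ T R tau (orbit_power H theta) _ x (orbit_power_le H theta)). Qed.

Lemma measurable_mean_power H theta : measurable_fun setT (mean_power H theta).
Proof.
apply: (measurable_upper_average htau).
exact: integrable_measurable (integrable_orbit_power H theta).
Qed.

(** The van der Corput estimate with [r] = e/4 bounds the average by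
    r + r/2 + r once the mean window power is below r^2. *)
Lemma cvg0_of_small_mean_power x theta t :
  (forall e, 0 < e -> exists2 H, (0 < H)%N & mean_power H theta x < e) ->
  avg (fun k => cos (k%:R * theta + t) * f (iter k tau x)) @ \oo --> (0 : R).
Proof.
move=> small; apply/cvgrPdist_le => e e0.
pose r := e / 4; have r0 : 0 < r by rewrite divr_gt0.
have [H H0 HP] := small (r ^+ 2) (exprn_gt0 _ r0).
have lt := ulim_lt (orbit_power_avg_le H theta x) HP.
near=> n; rewrite sub0r normrN.
have n0 : (0 < n)%N by near: n; exact: nbhs_infty_gt.
apply: (le_trans (van_der_corput theta t (fun k => fC (iter k tau x)) r0 H0 n0)).
have h1 : avg (orbit (orbit_power H theta) x) n < r ^+ 2 by near: n; exact: lt.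
have h2 : H%:R * (2 * C) / n%:R <= r by near: n; exact: near_div_le.
have E : avg (fun k => window_power H theta (fun j => f (iter (k + j) tau x))) n =
    avg (orbit (orbit_power H theta) x) n by apply: eq_avg => k; rewrite orbit_power_iter.
rewrite E.
have h3 : avg (orbit (orbit_power H theta) x) n / (2 * r) <= r / 2.
  rewrite ler_pdivrMr ?mulr_gt0// (le_trans (ltW h1))//.
  by rewrite le_eqVlt; apply/orP; left; apply/eqP; rewrite expr2; field.
rewrite /r in h2 h3 *; lra.
Unshelve. all: by end_near. Qed.

(** Rational frequencies suffice here because the window powers are Lipschitz in
    the frequency, uniformly along the orbit. *)
Definition regular_point x := forall (q : rat) H,
  avg (orbit (orbit_power H (ratr q)) x) @ \oo --> mean_power H (ratr q) x.

Lemma ae_regular_point : {ae mu, forall x, regular_point x}.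
Proof.
pose q (n : nat) : rat * nat := odflt (0, 0%N) (unpickle n).
have K n : {ae mu, forall x, avg (orbit (orbit_power (q n).2 (ratr (q n).1)) x) @ \oo -->
    mean_power (q n).2 (ratr (q n).1) x}.
  exact: (birkhoff_bounded htau (integrable_orbit_power _ _) (orbit_power_le _ _)).
have {}K := ae_foralln K; apply: filterS K => x Hx r H.
by have := Hx (pickle (r, H)); rewrite /q pickleK.
Qed.

(** A rational frequency at distance less than [r] from [theta] costs e/3 twice,
    and convergence at that frequency costs e/3. *)
Lemma regular_point_lower x H theta e : regular_point x -> 0 < e ->
  \forall n \near \oo, mean_power H theta x <= avg (orbit (orbit_power H theta) x) n + e.
Proof.
move=> rx e0; have L0 : 0 <= lip H by rewrite /lip mulr_ge0 ?sqr_ge0// mulr_ge0.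
have L1 : 0 < lip H + 1 by rewrite ltr_wpDl.
pose r := e / 3 / (lip H + 1); have r0 : 0 < r by rewrite !divr_gt0.
have [q] : exists q : rat, ratr q \in `]theta - r, theta + r[.
  by apply: rat_in_itvoo; lra.
rewrite in_itv/= => /andP[q1 q2].
have d1 : lip H * `|theta - ratr q| <= e / 3.
  rewrite (@le_trans _ _ ((lip H + 1) * r))//; last by rewrite /r mulrC divfK ?gt_eqF.
  by rewrite ler_pM// ?lerDl// ler_norml; apply/andP; split; lra.
have /cvgrPdist_le/(_ (e / 3)) cq := rx q H.
have e30 : 0 < e / 3 by rewrite divr_gt0.
near=> n.
have h1 := mean_power_lipschitz H theta (ratr q) x.
have h2 := orbit_power_avg_lipschitz H (ratr q) theta x n.
have : `|mean_power H (ratr q) x - avg (orbit (orbit_power H (ratr q)) x) n| <= e / 3.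
  by near: n; exact: cq.
rewrite ler_norml => /andP[_ h3].
rewrite (distrC (ratr q)) in h2.
lra.
Unshelve. all: by end_near. Qed.

Lemma sin_half_neq0 (y z : R) : 0 <= y <= pi -> 0 <= z <= pi -> y != z ->
  sin ((y - z) / 2) != 0.
Proof.
have W (u v : R) : 0 <= u <= pi -> 0 <= v <= pi -> u < v -> 0 < sin ((v - u) / 2).
  move=> /andP[u0 up] /andP[v0 vp] uv; apply: sin_gt0_pi.
  by have := @pi_gt0 R; lra.
move=> yr zr; rewrite neq_lt => /orP[] h; last by rewrite gt_eqF// W.
by rewrite -opprB mulNr sinN oppr_eq0 gt_eqF// W.
Qed.

(** The finite-window Bessel inequality holds at every point of the orbit, hence
    for the Cesaro means; at a regular point these means simultaneously approach
    the mean powers at all frequencies in [s]. *)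
Lemma exceptional_frequencies_card x delta (s : seq R) : regular_point x -> uniq s ->
  (forall y, y \in s -> 0 <= y <= pi /\ forall h, delta <= mean_power h.+1 y x) ->
  (size s)%:R * delta <= C ^+ 2.
Proof.
move=> rx us sP.
have [|K KP] := @bessel_window R s C us.
  by move=> y z ys zs yz; apply: sin_half_neq0 => //; [case: (sP _ ys)|case: (sP _ zs)].
apply/ler_addgt0Pr => e e0.
have e20 : 0 < e / 2 by rewrite divr_gt0.
have [h hK] : exists h : nat, K / h.+1%:R <= e / 2.
  have [n _ nP] := near_div_le K e20.
  by exists n; exact: (nP n.+1 (leqnSn n)).
have [n nP] : exists n, forall y, y \in s ->
    mean_power h.+1 y x <= avg (orbit (orbit_power h.+1 y) x) n + e / 2 / (size s).+1%:R.
  have ev : \forall n \near \oo, forall i : 'I_(size s),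
      mean_power h.+1 s`_i x <= avg (orbit (orbit_power h.+1 s`_i) x) n + e / 2 / (size s).+1%:R.
    apply: (@filter_forall nat 'I_(size s) (fun i => [set n |
      mean_power h.+1 s`_i x <= avg (orbit (orbit_power h.+1 s`_i) x) n + e / 2 / (size s).+1%:R]) \oo _ _).
    by move=> i; apply: regular_point_lower => //; rewrite divr_gt0.
  case: ev => n _ nP; exists n => y ys.
  have := nP n (leqnn n) (Ordinal (_ : (index y s < size s)%N)).
  by rewrite /= index_mem => /(_ ys); rewrite nth_index.
have : (size s)%:R * delta <=
    \sum_(y <- s) (avg (orbit (orbit_power h.+1 y) x) n + e / 2 / (size s).+1%:R).
  rewrite -[X in X%:R * _]count_predT -sum1_count natr_sum mulr_suml.
  rewrite big_seq [leRHS]big_seq ler_sum// => y ys.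
  by rewrite mul1r (le_trans _ (nP y ys))//; case: (sP _ ys).
rewrite big_split/= -avg_sum => h1.
have h2 : avg (fun k => \sum_(y <- s) orbit_power h.+1 y (iter k tau x)) n <=
    C ^+ 2 + e / 2.
  apply: avg_le_cst; first by rewrite addr_ge0 ?sqr_ge0// ltW.
  move=> k; apply: le_trans (KP h.+1 (orbit f (iter k tau x)) _ _) _ => //.
  by rewrite lerD2l.
have h3 : \sum_(y <- s) e / 2 / (size s).+1%:R <= e / 2.
  rewrite big_const_seq count_predT iter_addr addr0 -[_ *+ size s]mulr_natr mulrAC.
  rewrite ler_pdivrMr ?ltr0n// ler_wpM2l ?(ltW e20)//.
  by rewrite ler_nat.
lra.
Qed.

(** If exceptional frequencies accumulated at [theta] from the left, one could
    pick arbitrarily many distinct ones, contradicting their finiteness. *)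
Lemma exceptional_frequency_isolated x delta theta : regular_point x -> 0 < delta ->
  0 < theta <= pi ->
  exists p : rat, 0 <= (ratr p : R) < theta /\
    forall y, ratr p <= y < theta -> exists h, mean_power h.+1 y x < delta.
Proof.
move=> rx d0 /andP[th0 thpi]; apply: contrapT => /forallNP np.
have {np}np (b : R) : 0 <= b < theta -> exists y, b < y < theta /\
    forall h, delta <= mean_power h.+1 y x.
  move=> /andP[b0 bth].
  have /rat_in_itvoo[p] := bth; rewrite in_itv/= => /andP[bp pth].
  have := np p; rewrite (le_trans b0 (ltW bp)) pth => /not_andP[//|].
  move=> /existsNP[y /not_implyP[/andP[py yth] /forallNP H]].
  exists y; rewrite yth (lt_le_trans bp py); split => // h.
  by rewrite leNgt; apply/negP; exact: H.
have K m : exists s : seq R, exists2 b, 0 <= b < theta & [/\ uniq s, size s = m &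
    forall y, y \in s -> 0 <= y <= b /\ forall h, delta <= mean_power h.+1 y x].
  elim: m => [|m [s [b /andP[b0 bth] [us sm sP]]]].
    by exists [::]; exists 0; [rewrite lexx th0 | split].
  have [|y [/andP[by1 yth] yP]] := np b; first by rewrite b0 bth.
  have y0 : 0 <= y by rewrite (le_trans b0)// ltW.
  exists (y :: s), y; first by rewrite y0 yth.
  split => /=; last 1 first.
  - move=> z; rewrite inE => /orP[/eqP ->|zs]; first by rewrite y0 lexx.
    have [/andP[z0 zb] zP] := sP z zs.
    by rewrite z0 (le_trans zb)// ltW.
  - rewrite us andbT; apply/negP => /sP[/andP[_ yb] _].
    by move: by1; rewrite ltNge yb.
  - by rewrite sm.
have [m mP] : exists m : nat, C ^+ 2 / delta < m%:R.
  by exists (Num.truncn (C ^+ 2 / delta)).+1; exact: truncnS_gt.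
have [s [b /andP[b0 bth] [us sm sP]]] := K m.
have : (size s)%:R * delta <= C ^+ 2.
  apply: (exceptional_frequencies_card rx us) => y /sP[/andP[y0 yb] H]; split => //.
  by rewrite y0 (le_trans yb)// (le_trans (ltW bth)).
by rewrite sm leNgt -ltr_pdivrMr// mP.
Qed.

(** The first exceptional frequency of level 1/(j+1) after [p]; a starting point
    outside [0, pi] is replaced by 0, so that the value is always an angle in
    that interval. *)
Definition selector (p : rat) (j : nat) (x : T) : R :=
  first_hit (fun h theta => mean_power h.+1 theta x) j.+1%:R^-1
    (if 0 <= (ratr p : R) <= pi then ratr p else 0) pi.

Lemma selector_range p j x : 0 <= selector p j x <= pi.
Proof.
rewrite /selector; case: ifP => [/andP[p0 ppi]|_].
  have /andP[h1 h2] := @first_hit_range _ (fun h theta => mean_power h.+1 theta x)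
    j.+1%:R^-1 _ _ ppi.
  by rewrite (le_trans p0 h1).
exact: first_hit_range (pi_ge0 R).
Qed.

Lemma selector_invariant p j x : selector p j (tau x) = selector p j x.
Proof.
rewrite /selector; congr first_hit; apply/funext => h; apply/funext => theta.
exact: mean_power_invariant.
Qed.

Lemma measurable_avoids delta p t :
  measurable [set x | avoids (fun h theta => mean_power h.+1 theta x) delta p t].
Proof.
pose q (k : nat) : rat := odflt 0 (unpickle k).
pose A n k : set T := if p <= ratr (q k) <= t then
  \bigcup_(h in [set h | (h <= n)%N])
    [set x | mean_power h.+1 (ratr (q k)) x <= delta - n.+1%:R^-1] else setT.
rewrite (_ : [set x | _] = \bigcup_n \bigcap_k A n k).
  apply: bigcup_measurable => n _; apply: bigcapT_measurable => k.
  rewrite /A; case: ifP => // _; apply: bigcup_measurable => h _.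
  by apply: measurable_set_ler => //; exact: measurable_mean_power.
apply/seteqP; split => x.
  move=> [n nP]; exists n => // k _; rewrite /A; case: ifP => // qk.
  by have [h hn hl] := nP _ qk; exists h.
move=> [n _ nP]; exists n => r rpt.
have := nP (pickle r) I; rewrite /A /q pickleK /= rpt => -[h hn hl].
by exists h.
Qed.

Lemma measurable_selector p j : measurable_fun setT (selector p j).
Proof.
rewrite /selector; set b := (if _ then _ else _); set delta := _^-1.
have bpi : b <= pi by rewrite /b; case: ifP => [/andP[]//|_]; exact: pi_ge0.
apply: measurable_fun_sups => [x _|n].
  by exists pi; exact: candidate_ubound.
rewrite /candidate; set r := ratr _.
apply: measurable_fun_ifT => //; apply: (measurable_fun_bool true).
rewrite setTI; have [br|br] := boolP (b <= r <= pi).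
  rewrite (_ : _ @^-1` _ =
      [set x | avoids (fun h theta => mean_power h.+1 theta x) delta b r]).
    exact: measurable_avoids.
  by apply/seteqP; split => x /=; [move/asboolP => [] | move=> h; apply/asboolP].
rewrite (_ : _ @^-1` _ = set0)//.
by apply/seteqP; split => x //= /asboolP[h _]; case/negP: br.
Qed.

(** The frequency 0 is handled apart: it has no rational number of [0, pi] to
    its left from which it could be selected. *)
Theorem wiener_wintner : {ae mu, forall x theta t, 0 <= theta <= pi ->
  cvg (avg (fun k => cos (k%:R * theta + t) * f (iter k tau x)) @ \oo)}.
Proof.
have pi2 (y : R) : 0 <= y <= pi -> 0 <= y < 2 * pi.
  by move=> /andP[-> h]; rewrite (le_lt_trans h)// ltr_pMl ?pi_gt0// ltr1n.
have S0 : {ae mu, forall x t,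
    cvg (avg (fun k => cos (k%:R * 0 + t) * f (iter k tau x)) @ \oo)}.
  apply: (twisted_birkhoff htau (theta := fun=> 0) _ _ _ fi fC) => // x.
  by rewrite lexx mulr_gt0 ?pi_gt0.
pose q (n : nat) : rat * nat := odflt (0, 0%N) (unpickle n).
have S1 n : {ae mu, forall x t, cvg (avg (fun k =>
    cos (k%:R * selector (q n).1 (q n).2 x + t) * f (iter k tau x)) @ \oo)}.
  apply: (twisted_birkhoff htau _ _ _ fi fC).
  - exact: measurable_selector.
  - by move=> x; apply: pi2; exact: selector_range.
  - exact: selector_invariant.
have {}S1 := ae_foralln S1.
have S2 := ae_regular_point.
move: S0 S1 S2; apply: filterS3 => x x0 x1 x2 theta t /andP[th0 thpi].
have [->|thn0] := eqVneq theta 0; first exact: x0.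
have thp : 0 < theta by rewrite lt_neqAle eq_sym thn0.
have [small|] := pselect (forall e, 0 < e ->
    exists2 H, (0 < H)%N & mean_power H theta x < e).
  by apply/cvg_ex; exists 0; exact: cvg0_of_small_mean_power.
move=> /existsNP[e /not_implyP[e0 big]].
have [j je] := natSinv_lt e0.
have d0 : 0 < j.+1%:R^-1 :> R by rewrite invr_gt0 ltr0n.
have [|p [/andP[p0 pth] pP]] := @exceptional_frequency_isolated x j.+1%:R^-1 theta x2 d0.
  by rewrite thp thpi.
have := x1 (pickle (p, j)) t; rewrite /q pickleK /=.
rewrite (_ : selector p j x = theta)//.
rewrite /selector p0 (le_trans (ltW pth) thpi)/=.
apply: first_hit_eq => //.
- by move=> h; exact: mean_power_continuous.
- by rewrite pth thpi.
- move=> h; rewrite leNgt; apply/negP => lt; apply: big.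
  by exists h.+1 => //; exact: lt_trans lt je.
Qed.

End wiener_wintner.

(** * Complex numbers by real and imaginary parts *)

Section complex_parts.
Context {R : realType}.
Implicit Types (z w : R[i]) (r : R).

Notation Re := (@complex.Re R).
Notation Im := (@complex.Im R).
Notation normc := (@Normc.normc R).

Lemma ReD z w : Re (z + w) = Re z + Re w.
Proof. by case: z => a b; case: w. Qed.

Lemma ReB z w : Re (z - w) = Re z - Re w.
Proof. by case: z => a b; case: w. Qed.

Lemma ReZ r z : Re (r%:C%C * z) = r * Re z.
Proof. by case: z => a b /=; rewrite mul0r subr0. Qed.

Lemma Re_sum (I : Type) (s : seq I) (P : pred I) (F : I -> R[i]) :
  Re (\sum_(i <- s | P i) F i) = \sum_(i <- s | P i) Re (F i).
Proof. by apply: (big_morph Re ReD). Qed.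

Lemma invr_nat_complex n : (n%:R : R[i])^-1 = (n%:R^-1 : R)%:C%C.
Proof. by rewrite fmorphV rmorph_nat. Qed.

Lemma normc_ge_absRe z : `|Re z| <= normc z.
Proof.
case: z => a b /=; rewrite -sqrtr_sqr ler_wsqrtr// lerDl; exact: sqr_ge0.
Qed.

Lemma normc_ge_absIm z : `|Im z| <= normc z.
Proof.
case: z => a b /=; rewrite -sqrtr_sqr ler_wsqrtr// lerDr; exact: sqr_ge0.
Qed.

Lemma normc_ge0 z : 0 <= normc z.
Proof. by case: z => a b; exact: sqrtr_ge0. Qed.

Lemma normc_le_parts z : normc z <= `|Re z| + `|Im z|.
Proof.
case: z => a b /=; rewrite -[leRHS]ger0_norm ?addr_ge0// -sqrtr_sqr ler_wsqrtr//.
by rewrite sqrrD !real_normK ?num_real// lerD2r lerDl mulrn_wge0 ?mulr_ge0.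
Qed.

Lemma cvg_complex_parts (u : nat -> R[i]^o) (a b : R) :
  (fun n => Re (u n)) @ \oo --> a -> (fun n => Im (u n)) @ \oo --> b ->
  u @ \oo --> ((a +i* b)%C : R[i]^o).
Proof.
move=> /cvgrPdist_le ua /cvgrPdist_le ub; apply/cvgrPdist_le => -[e e'].
rewrite ltcE /= => /andP[/eqP e'0 e0].
have e20 : 0 < e / 2 by rewrite divr_gt0.
near=> n; rewrite e'0.
have h1 : `|a - Re (u n)| <= e / 2 by near: n; exact: ua.
have h2 : `|b - Im (u n)| <= e / 2 by near: n; exact: ub.
change ((normc ((a +i* b)%C - u n))%:C%C <= e%:C%C).
rewrite lecR (le_trans (normc_le_parts _))//.
move: h1 h2; case: (u n) => c c' /=; lra.
Unshelve. all: by end_near. Qed.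

(** Up to conjugation, recorded by the sign [s], a unit has its argument in
    [0, pi]; the sequences considered below are real, so frequencies in that
    interval suffice. *)
Lemma unit_complex_trig z : normc z = 1 ->
  exists theta s : R, 0 <= theta <= pi /\ z = (cos theta +i* (s * sin theta))%C /\ s ^+ 2 = 1.
Proof.
case: z => a b /= h.
have ab : a ^+ 2 + b ^+ 2 = 1.
  by rewrite -[LHS]sqr_sqrtr ?h ?expr1n// addr_ge0 ?sqr_ge0.
have a1 : -1 <= a <= 1.
  by rewrite -ler_norml -(@ler_pXn2r _ 2) ?nnegrE// expr1n real_normK ?num_real// -ab lerDl sqr_ge0.
have E : 1 - a ^+ 2 = b ^+ 2 by rewrite -ab addrAC subrr add0r.
exists (acos a), (if 0 <= b then 1 else -1); split; [|split].
- by rewrite acos_ge0// acos_lepi.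
- rewrite acosK ?in_itv//= sin_acos// E sqrtr_sqr; congr Complex.
  case: ifPn => [b0|]; first by rewrite mul1r ger0_norm.
  by rewrite -ltNge => b0; rewrite mulN1r ltr0_norm ?opprK.
- by case: ifP; rewrite ?sqrrN expr1n.
Qed.

Lemma de_moivre theta (s : R) k : s ^+ 2 = 1 ->
  (cos theta +i* (s * sin theta))%C ^+ k =
  (cos (k%:R * theta) +i* (s * sin (k%:R * theta)))%C.
Proof.
move=> s1; elim: k => [|k IH]; first by rewrite expr0 mul0r cos0 sin0 mulr0.
rewrite exprS IH -natr1 mulrDl mul1r addrC cosD sinD; congr Complex.
  by rewrite mulrACA -expr2 s1 mul1r.
by rewrite mulrDr addrC; congr (_ + _); ring.
Qed.

End complex_parts.

(** * Besicovitch weights along a single sequence *)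

Section weighted_sequences.
Context {R : realType}.
Implicit Types (a b : nat -> R) (F G beta : nat -> R[i]).

Notation Re := (@complex.Re R).
Notation Im := (@complex.Im R).
Notation normc := (@Normc.normc R).

(** The phase [t] makes one condition cover both cosines and sines. *)
Definition wiener_wintner_sequence a := forall theta t : R, 0 <= theta <= pi ->
  cvg (avg (fun k => cos (k%:R * theta + t) * a k) @ \oo).

Lemma is_cvg_avg_trig_poly a b (P : int -> R[i]) : wiener_wintner_sequence a -> wiener_wintner_sequence b ->
  trig_poly P -> cvg (avg (fun k => Re (P k%:Z * (a k +i* b k)%C)) @ \oo).
Proof.
move=> wa wb [s [z [lambda [l1 PE]]]].
rewrite (_ : avg _ = avg (fun k => \sum_(j < s) Re (z j * lambda j ^ k%:Z * (a k +i* b k)%C))).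
  apply: is_cvg_avg_sum => j.
  have [theta [e [th [-> e1]]]] := unit_complex_trig (l1 j).
  case: (z j) => p q.
  rewrite (_ : avg _ = (fun n =>
    p * avg (fun k => cos (k%:R * theta + 0) * a k) n
    - p * e * avg (fun k => cos (k%:R * theta + - (pi / 2)) * b k) n
    - q * avg (fun k => cos (k%:R * theta + 0) * b k) n
    - q * e * avg (fun k => cos (k%:R * theta + - (pi / 2)) * a k) n)).
    apply: is_cvgB; last by apply: is_cvgMr; exact: wa.
    apply: is_cvgB; last by apply: is_cvgMr; exact: wb.
    apply: is_cvgB; last by apply: is_cvgMr; exact: wb.
    by apply: is_cvgMr; exact: wa.
  apply/funext => n; rewrite -!avgZ -!avgB; apply: eq_avg => k.
  rewrite -exprnP (de_moivre _ _ e1) cosBpihalf addr0 /=; ring.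
apply/funext => n; apply: eq_avg => k.
by rewrite PE mulr_suml Re_sum.
Qed.

(** Limits, in the Cesaro seminorm, of bounded complex sequences whose real and
    imaginary parts are Wiener-Wintner sequences. *)
Definition wiener_wintner_approximable F := forall e : R, 0 < e ->
  exists (a b : nat -> R) (M : R), [/\ wiener_wintner_sequence a, wiener_wintner_sequence b,
    forall k, `|a k| <= M, forall k, `|b k| <= M &
    forall n, (0 < n)%N -> avg (fun k => normc (F k - (a k +i* b k)%C)) n <= e].

(** With G = a + ib close to [F] and [P] close to [beta], the difference
    beta F - P G = beta (F - G) + (beta - P) G is small in Cesaro mean because
    [beta] and [G] are bounded; [P] is chosen after [G], with an accuracy that
    depends on the bound of [G]. *)
Lemma besicovitch_real_part F beta : wiener_wintner_approximable F ->
  bounded_besicovitch beta -> cvg (avg (fun k => Re (beta k * F k)) @ \oo).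
Proof.
move=> wF [[C bC] bes]; apply: is_cvg_approx => e e0.
have C0 : 0 <= C by exact: le_trans (normc_ge0 _) (bC 0%N).
have [|a [b [M [wa wb aM bM FG]]]] := wF (e / 2 / (C + 1)).
  by rewrite !divr_gt0// ltr_wpDl.
have M0 : 0 <= M by exact: le_trans (aM 0%N).
have e2 : 0 < e / 2 / (2 * M + 1) by rewrite !divr_gt0// ltr_wpDl// mulr_ge0.
have [P tP /esup_lt_near bP] := bes _ e2.
exists (avg (fun k => Re (P k%:Z * (a k +i* b k)%C))); first exact: is_cvg_avg_trig_poly.
near=> n.
have n0 : (0 < n)%N by near: n; exact: nbhs_infty_gt.
have h1 := FG n n0.
have h2 : avg (fun k => normc (beta k - P k%:Z)) n < e / 2 / (2 * M + 1).
  by near: n.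
rewrite -avgB (le_trans (ler_norm_avg _ _))//.
rewrite (le_trans (ler_avg (v := fun k => C * normc (F k - (a k +i* b k)%C) +
   2 * M * normc (beta k - P k%:Z)) _ _))//.
  move=> k; rewrite -ReB (le_trans (normc_ge_absRe _))//.
  have -> : beta k * F k - P k%:Z * (a k +i* b k)%C =
    beta k * (F k - (a k +i* b k)%C) + (beta k - P k%:Z) * (a k +i* b k)%C by ring.
  rewrite (le_trans (le_normcD _ _))// !Normc.normcM lerD//.
    by rewrite ler_wpM2r ?normc_ge0.
  rewrite mulrC ler_wpM2r ?normc_ge0// (le_trans (normc_le_parts _))//=.
  by rewrite mulr_natl mulr2n lerD.
rewrite avgD !avgZ.
have k1 : C * avg (fun k => normc (F k - (a k +i* b k)%C)) n <= e / 2.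
  rewrite (@le_trans _ _ ((C + 1) * (e / 2 / (C + 1))))//.
    by rewrite ler_pM// ?lerDl// avg_ge0// => k; exact: normc_ge0.
  by rewrite mulrC divfK// gt_eqF// ltr_wpDl.
have k2 : 2 * M * avg (fun k => normc (beta k - P k%:Z)) n <= e / 2.
  rewrite (@le_trans _ _ ((2 * M + 1) * (e / 2 / (2 * M + 1))))//.
    apply: ler_pM; [exact: mulr_ge0| |by rewrite lerDl|exact: ltW].
    by apply: avg_ge0 => k; exact: normc_ge0.
  by rewrite mulrC divfK// gt_eqF// ltr_wpDl// mulr_ge0.
lra.
Unshelve. all: by end_near. Qed.

(** Multiplying the weights by i turns statements on real parts into statements
    on imaginary parts. *)
Lemma bounded_besicovitchMi beta : bounded_besicovitch beta ->
  bounded_besicovitch (fun k => beta k * 'i%C).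
Proof.
have ni : normc 'i%C = 1 by rewrite /= expr0n/= add0r expr1n sqrtr1.
move=> [[C bC] bes]; split.
  by exists C => k; rewrite Normc.normcM ni mulr1.
move=> e e0; have [P [s [z [l [l1 PE]]]] bP] := bes e e0.
exists (fun k => P k * 'i%C).
  exists s, (fun j => z j * 'i%C), l; split => // k.
  by rewrite PE mulr_suml; apply: eq_bigr => j _; rewrite mulrAC.
congr (limn_esup _ < _)%E: bP; apply/funext => n; congr (_ * _)%:E.
by apply: eq_bigr => k _; rewrite -mulrBl Normc.normcM ni mulr1.
Qed.

Theorem besicovitch_average F beta : wiener_wintner_approximable F ->
  bounded_besicovitch beta ->
  exists l : R[i]^o,
    (fun n => n%:R^-1 * \sum_(0 <= k < n) beta k * F k : R[i]^o) @ \oo --> l.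
Proof.
move=> wF bes.
have /cvg_ex[a ca] := besicovitch_real_part wF bes.
have /cvg_ex[b cb] := besicovitch_real_part wF (bounded_besicovitchMi bes).
exists (a +i* - b)%C; apply: cvg_complex_parts.
  rewrite (_ : (fun n => _) = avg (fun k => Re (beta k * F k)))//.
  by apply/funext => n; rewrite invr_nat_complex ReZ Re_sum.
rewrite (_ : (fun n => _) = (fun n => - avg (fun k => Re (beta k * 'i%C * F k)) n)).
  exact: cvgN.
apply/funext => n; rewrite /avg -(opprK (Im _)) -ReiNIm.
rewrite -mulrA invr_nat_complex ReZ mulr_suml Re_sum.
by congr (- (_ * _)); apply: eq_bigr => k _; rewrite mulrAC.
Qed.

End weighted_sequences.

(** * Truncations of a function of R_mu *)

Section truncation.
Context d (T : measurableType d) (R : realType).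
Variable mu : {measure set T -> \bar R}.
Variable f : T -> R[i].
Hypothesis fR : Rmu mu f.

Notation normc := (@Normc.normc R).
Notation integrable_real f := (mu.-integrable [set: T] (EFin \o f)).

Lemma measurable_normc (g : T -> R[i]) : cmeasurable g ->
  measurable_fun setT (fun x => normc (g x)).
Proof.
move=> [mr mi]; rewrite (_ : (fun x => _) = (fun x =>
    Num.sqrt (complex.Re (g x) ^+ 2 + complex.Im (g x) ^+ 2))); last first.
  by apply/funext => x; case: (g x).
apply: (measurableT_comp (f := @Num.sqrt R)).
  by apply: continuous_measurable_fun; exact: sqrt_continuous.
by apply: measurable_funD; exact: measurable_funX.
Qed.

Lemma Rmu_measurable : cmeasurable f.
Proof.
have [[g [h [[[gr gi] _] [[hr hi] _] ->]]] _] := fR.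
split.
  rewrite (_ : (fun x => _) = (fun x => complex.Re (g x) + complex.Re (h x))).
    exact: measurable_funD.
  by apply/funext => x; rewrite ReD.
rewrite (_ : (fun x => _) = (fun x => complex.Im (g x) + complex.Im (h x))).
  exact: measurable_funD.
by apply/funext => x; case: (g x) => a b; case: (h x).
Qed.

Let mf := measurable_normc Rmu_measurable.

Definition above (c : R) : set T := [set x | c < normc (f x)].

Lemma measurable_above c : measurable (above c).
Proof. exact: measurable_set_ltr. Qed.

Lemma above_finite c : 0 < c -> (mu (above c) < +oo)%E.
Proof. by move=> c0; have [_] := fR; apply. Qed.

(** The threshold is m+1 rather than m, so that it is always positive and the
    set above it has finite measure. *)
Definition upper_tail (m : nat) (x : T) : R := normc (f x) * \1_(above m.+1%:R) x.

Lemma upper_tail_ge0 m x : 0 <= upper_tail m x.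
Proof. by rewrite mulr_ge0// normc_ge0. Qed.

Lemma measurable_upper_tail m : measurable_fun setT (upper_tail m).
Proof.
apply: measurable_funM => //; apply: measurable_indic; exact: measurable_above.
Qed.

Lemma upper_tail_homo m n x : (m <= n)%N -> upper_tail n x <= upper_tail m x.
Proof.
move=> mn; rewrite /upper_tail ler_wpM2l ?normc_ge0// !indicE.
have [/set_mem h|_] := boolP (x \in above n.+1%:R); last by case: (_ \in _).
rewrite mem_set// /above/=; apply: le_lt_trans h; by rewrite ler_nat.
Qed.

(** If f = g + h with g integrable and |h| <= K almost everywhere, then the tail
    is bounded by |g| + K on a set of finite measure. *)
Lemma integrable_upper_tail m : integrable_real (upper_tail m).
Proof.
have [[g [h [[mg Lg] [mh Lh] fE]]] _] := fR.
have ng : measurable_fun setT (fun x => normc (g x)) := measurable_normc mg.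
(* The norm of order +oo is 0 by convention when [mu] is the zero measure; any
   bound then holds almost everywhere. *)
have [K [K0 hK]] : exists K : R, 0 <= K /\ {ae mu, forall x, normc (h x) <= K}.
  move: Lh; rewrite /finite_norm unlock; case: ifPn => [_ |].
    move=> /ess_supr_bounded[K hK]; exists `|K|; split => //.
    apply: filterS hK => x /=; rewrite ger0_norm ?normc_ge0// => /le_trans; apply.
    exact: ler_norm.
  rewrite -leNgt measure_le0 => /eqP mu0 _; exists 0; split => //.
  by exists setT; split.
apply/integrableP; split; first exact/measurable_EFinP/measurable_upper_tail.
have Ii := integrable_indicator (measurable_above m.+1%:R) (above_finite (ltr0Sn R m)).
have gi : integrable_real (fun x => normc (g x)).
  apply/integrableP; split; first exact/measurable_EFinP.
  by move: Lg; rewrite /finite_norm Lnorm1.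
have bi := integrable_addr gi (integrable_scaler K Ii).
case/integrableP: bi => mb; apply: le_lt_trans.
apply: ae_ge0_le_integral => //.
- by apply: measurableT_comp => //; exact/measurable_EFinP/measurable_upper_tail.
- exact: measurableT_comp.
apply: filterS hK => x hx _ /=.
rewrite lee_fin ger0_norm ?upper_tail_ge0// (le_trans _ (ler_norm _))//.
rewrite /upper_tail !indicE; case: (_ \in _); last by rewrite !mulr0 addr0 normc_ge0.
by rewrite !mulr1 fE (le_trans (le_normcD _ _))// lerD2l.
Qed.

Lemma integral_upper_tail_cvg0 : (fun m => \int[mu]_x upper_tail m x) @ \oo --> (0 : R).
Proof.
have [|||||_ _ cv] := @dominated_convergence _ _ _ mu setT measurableT
  (fun m x => (upper_tail m x)%:E) (cst 0%E) (fun x => (upper_tail 0 x)%:E).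
- by move=> m; apply/measurable_EFinP; exact: measurable_upper_tail.
- exact: measurable_cst.
- apply: aeW => x _.
  apply: cvg_near_cst; exists (Num.truncn (normc (f x))) => // m /= xm.
  rewrite /upper_tail indicE memNset ?mulr0// /above /=; apply/negP; rewrite -leNgt.
  rewrite (le_trans (ltW (truncnS_gt _)))// ler_nat ltnS//.
- exact: integrable_upper_tail.
- by apply: aeW => x n _ /=; rewrite lee_fin ger0_norm ?upper_tail_ge0// upper_tail_homo.
rewrite integral0 in cv.
by have /fine_cvgP[_] := cv.
Qed.

(** By the maximal inequality, the set where some average of the [m]-th tail
    exceeds 1/(j+1) has measure at most (j+1) times the integral of that tail,
    so the intersection of these sets over [m] is null. *)
Lemma upper_tail_average (tau : T -> T) : measure_preserving mu tau ->
  {ae mu, forall x e, 0 < e -> exists M, forall m n, (M <= m)%N -> (0 < n)%N ->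
    avg (fun k => upper_tail m (iter k tau x)) n <= e}.
Proof.
move=> htau.
have H j : {ae mu, forall x, exists M, forall n, (0 < n)%N ->
    avg (fun k => upper_tail M (iter k tau x)) n <= j.+1%:R^-1}.
  have d0 : 0 < j.+1%:R^-1 :> R by rewrite invr_gt0 ltr0n.
  pose A m := maximal_set tau (upper_tail m) j.+1%:R^-1.
  have mA m : measurable (A m).
    by have := measurable_maximal_set htau j.+1%:R^-1 (measurable_upper_tail m).
  exists (\bigcap_m A m); split; first exact: bigcapT_measurable.
    apply/eqP; rewrite -measure_le0; apply/lee_addgt0Pr => e e0; rewrite add0e.
    have [m _ mP] : \forall m \near \oo, j.+1%:R * \int[mu]_x upper_tail m x <= e.
      have e1 : 0 < e / j.+1%:R by rewrite divr_gt0.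
      have /cvgrPdist_le/(_ _ e1) := integral_upper_tail_cvg0.
      apply: filterS => m; rewrite sub0r normrN => h.
      by rewrite mulrC -ler_pdivlMr// (le_trans (ler_norm _)).
    apply: (@le_trans _ _ (mu (A m))).
      by apply: le_measure; rewrite ?inE//; [exact: bigcapT_measurable | move=> x; apply].
    apply: (le_trans (maximal_inequality htau (integrable_upper_tail m) (upper_tail_ge0 m) d0)).
    by rewrite lee_fin invrK; exact: (mP m (leqnn m)).
  move=> x /= /forallNP nx m _.
  have /existsNP[n /not_implyP[n0 /negP]] := nx m; rewrite -ltNge => lt.
  exact: maximal_setP n0 lt.
have {}H := ae_foralln H; apply: filterS H => x Hx e e0.
have [j je] := natSinv_lt e0; have [M MP] := Hx j.
exists M => m n Mm n0; rewrite (le_trans _ (ltW je))// (le_trans _ (MP n n0))//.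
by apply: ler_avg => k; exact: upper_tail_homo.
Qed.

(** The set where |f| lies in ]1/(m+1), m+1]. *)
Definition middle (m : nat) : set T := above m.+1%:R^-1 `\` above m.+1%:R.

Lemma measurable_middle m : measurable (middle m).
Proof. by apply: measurableD; exact: measurable_above. Qed.

Lemma middle_finite m : (mu (middle m) < +oo)%E.
Proof.
apply: (@le_lt_trans _ _ (mu (above m.+1%:R^-1))); last exact: above_finite.
apply: le_measure; rewrite ?inE; [exact: measurable_middle|exact: measurable_above|].
by move=> x [].
Qed.

Lemma middle_bounded (p : R[i] -> R) m x : (forall z, `|p z| <= normc z) ->
  `|p (f x) * \1_(middle m) x| <= m.+1%:R.
Proof.
move=> pz; rewrite normrM indicE; have [/set_mem [_ /= /negP]|_] := boolP (_ \in _).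
  by rewrite -leNgt normr1 mulr1; exact: le_trans (pz _).
by rewrite normr0 mulr0.
Qed.

Lemma integrable_middle (p : R[i] -> R) m : (forall z, `|p z| <= normc z) ->
  measurable_fun setT (fun x => p (f x)) ->
  integrable_real (fun x => p (f x) * \1_(middle m) x).
Proof.
move=> pz mp.
apply: (integrable_le _ _ (integrable_scaler m.+1%:R
  (integrable_indicator (measurable_middle m) (middle_finite m)))).
  by apply: measurable_funM => //; apply: measurable_indic; exact: measurable_middle.
move=> x; have := middle_bounded m x pz; rewrite !normrM !indicE.
by case: (_ \in _); rewrite ?normr1 ?normr0 ?mulr1 ?mulr0// normr_nat.
Qed.

Lemma middle_approx m x :
  normc (f x - ((complex.Re (f x) * \1_(middle m) x) +i*
                (complex.Im (f x) * \1_(middle m) x))%C) <= m.+1%:R^-1 + upper_tail m x.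
Proof.
rewrite indicE; have [h|/negP h] := boolP (x \in middle m).
  have -> : ((complex.Re (f x) * true%:R) +i* (complex.Im (f x) * true%:R))%C = f x.
    by rewrite !mulr1; case: (f x).
  by rewrite subrr Normc.normc0 addr_ge0 ?upper_tail_ge0.
have -> : ((complex.Re (f x) * false%:R) +i* (complex.Im (f x) * false%:R))%C = 0.
  by rewrite !mulr0.
rewrite subr0 /upper_tail indicE.
have [x1|x1] := boolP (x \in above m.+1%:R); first by rewrite mulr1 lerDr.
rewrite mulr0 addr0 leNgt; apply/negP => lt; apply: h; rewrite inE; split => //.
by move/negP: x1; rewrite inE.
Qed.

End truncation.

(** * The weighted ergodic theorem *)

(** The real and imaginary parts of the truncations of [f] satisfy the
    Wiener-Wintner theorem off a null set; enlarging it by the null set for the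
    tails, the orbit of every remaining point is approximable in the required
    sense. *)
Theorem theorem5p6 (d : measure_display) (T : measurableType d) (R : realType)
    (mu : {sigma_finite_measure set T -> \bar R}) (tau : T -> T)
    (htau : measure_preserving mu tau)
    (f : T -> R[i]) (hf : Rmu mu f) :
  exists Omega_f : set T,
    [/\ measurable Omega_f, mu (~` Omega_f) = 0%E &
      forall (x : T) (beta : nat -> R[i]),
        Omega_f x -> bounded_besicovitch beta ->
        exists l : R[i]^o, weighted_average tau beta f x @ \oo --> l].
Proof.
have [mre mim] := Rmu_measurable hf.
pose re m x := complex.Re (f x) * \1_(middle f m) x.
pose im m x := complex.Im (f x) * \1_(middle f m) x.
have W (p : R[i] -> R) m : (forall z, `|p z| <= Normc.normc z) ->
    measurable_fun setT (fun x => p (f x)) ->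
    {ae mu, forall x, wiener_wintner_sequence (fun k => p (f (iter k tau x)) * \1_(middle f m) (iter k tau x))}.
  move=> pz mp.
  have := wiener_wintner htau (integrable_middle hf m pz mp) (fun x => middle_bounded f m x pz).
  by apply: filterS => x H theta t; exact: H.
have [N [mN N0 HN]] : {ae mu, forall x, wiener_wintner_approximable (fun k => f (iter k tau x))}.
  have A1 := ae_foralln (fun m => W _ m (@normc_ge_absRe R) mre).
  have A2 := ae_foralln (fun m => W _ m (@normc_ge_absIm R) mim).
  have A3 := upper_tail_average hf htau.
  move: A1 A2 A3; apply: filterS3 => x x1 x2 x3 e e0.
  have e20 : 0 < e / 2 by rewrite divr_gt0.
  have [M MP] := x3 _ e20; have [j je] := natSinv_lt e20.
  pose m := maxn M j.
  exists (fun k => re m (iter k tau x)), (fun k => im m (iter k tau x)), m.+1%:R; split.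
  - exact: x1.
  - exact: x2.
  - by move=> k; apply: middle_bounded; exact: normc_ge_absRe.
  - by move=> k; apply: middle_bounded; exact: normc_ge_absIm.
  move=> n n0; rewrite (le_trans (ler_avg _ (fun k => middle_approx f m (iter k tau x))))//.
  rewrite avgD avg_cst//.
  have h1 := MP m n (leq_maxl _ _) n0.
  have h2 : m.+1%:R^-1 <= j.+1%:R^-1 :> R.
    by rewrite lef_pV2 ?posrE ?ltr0n// ler_nat ltnS leq_maxr.
  rewrite (le_trans (lerD (le_trans h2 (ltW je)) h1))//.
  by rewrite -splitr.
exists (~` N); split; [exact: measurableC | by rewrite setCK |].
move=> x beta Nx bes; apply: besicovitch_average => //.
by apply: contrapT => h; apply: Nx; exact: HN.
Qed.
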